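(* Let $(\mathsf{C},\otimes_{\mathsf{C}},\mathbb{1}_{\mathsf{C}},\alpha^{\mathsf{C}},\lambda^{\mathsf{C}},\rho^{\mathsf{C}},\beta^{\mathsf{C}})$ be a symmetric monoidal category. There exists a pseudofunctor \[\mathsf{C}^{\otimes}:\mathrm{Pith}(\mathrm{Span}(\mathrm{Fin}))\to\mathrm{Cat}\] that sends a finite set $J$ to the product category $\mathsf{C}^{J}$ and sends a span $J\xleftarrow{f}A\xrightarrow{g}K$ to the functor $g_!f^*$, where $f^*:\mathsf{C}^J\to\mathsf{C}^A$ is precomposition along $f$, and $g_!:\mathsf{C}^A\to\mathsf{C}^K$ sends an $A$-indexed family $(x_a)_{a\in A}$ to the $K$-indexed family $\left(\bigotimes_{a\in g^{-1}(\{k\})}x_a\right)_{k\in K}$.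
   Context: $\mathrm{Fin}$ is the category of finite sets. For a category $C$ with pullbacks, $\mathrm{Span}(C)$ is the bicategory whose objects are objects of $C$, whose 1-morphisms $c\to c'$ are spans $c\xleftarrow{l}\widehat S\xrightarrow{r}c'$, whose 2-morphisms are morphisms between apices commuting with the legs, with identity spans $c\xleftarrow{\mathrm{Id}}c\xrightarrow{\mathrm{Id}}c$, composition given by pullback of the inner legs, and associators/unitors the canonical isomorphisms between pullbacks. For a bicategory $\mathsf{B}$, $\mathrm{Pith}(\mathsf{B})$ is the bicategory with the same objects and 1-morphisms as $\mathsf{B}$ but only the invertible 2-morphisms of $\mathsf{B}$. $\mathrm{Cat}$ is the bicategory of categories, functors and natural transformations. *)

(* Defs.v *)
From mathcomp Require Import ssreflect ssrfun ssrbool eqtype ssrnat seq choice fintype finfun.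
From Stdlib Require Import FunctionalExtensionality.

Set Implicit Arguments.
Unset Strict Implicit.
Unset Printing Implicit Defensive.

Record Category := {
  ob :> Type;
  hom : ob -> ob -> Type;
  idm : forall a, hom a a;
  comp : forall a b c, hom b c -> hom a b -> hom a c;
  comp_assoc : forall a b c d (h : hom c d) (g : hom b c) (f : hom a b),
      comp h (comp g f) = comp (comp h g) f;
  comp_id_l : forall a b (f : hom a b), comp (idm b) f = f;
  comp_id_r : forall a b (f : hom a b), comp f (idm a) = f
}.
Arguments hom {_} _ _.
Arguments idm {_} _.
Arguments comp {_ _ _ _} _ _.

Definition is_iso (C : Category) (a b : C) (f : hom a b) : Prop :=
  exists g : hom b a, comp g f = idm a /\ comp f g = idm b.

Record Functor (C D : Category) := {
  fobj :> C -> D;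
  fmap : forall a b, hom a b -> hom (fobj a) (fobj b);
  fmap_id : forall a, fmap (idm a) = idm (fobj a);
  fmap_comp : forall a b c (g : hom b c) (f : hom a b),
      fmap (comp g f) = comp (fmap g) (fmap f)
}.
Arguments fmap {_ _} _ {_ _} _.

Record NatTrans (C D : Category) (F G : Functor C D) := {
  ntc :> forall a, hom (F a) (G a);
  ntnat : forall a b (f : hom a b), comp (fmap G f) (ntc a) = comp (ntc b) (fmap F f)
}.

Record SymMonoidal (C : Category) := {
  tens : C -> C -> C;
  tensm : forall a a' b b', hom a a' -> hom b b' -> hom (tens a b) (tens a' b');
  tensm_id : forall a b, tensm (idm a) (idm b) = idm (tens a b);
  tensm_comp : forall a a' a'' b b' b'' (f' : hom a' a'') (f : hom a a')
      (g' : hom b' b'') (g : hom b b'),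
      tensm (comp f' f) (comp g' g) = comp (tensm f' g') (tensm f g);
  munit : C;
  alpha : forall a b c, hom (tens (tens a b) c) (tens a (tens b c));
  alpha_iso : forall a b c, is_iso (alpha a b c);
  alpha_nat : forall a a' b b' c c' (f : hom a a') (g : hom b b') (h : hom c c'),
      comp (alpha a' b' c') (tensm (tensm f g) h)
      = comp (tensm f (tensm g h)) (alpha a b c);
  lambda : forall a, hom (tens munit a) a;
  lambda_iso : forall a, is_iso (lambda a);
  lambda_nat : forall a a' (f : hom a a'),
      comp (lambda a') (tensm (idm munit) f) = comp f (lambda a);
  rho : forall a, hom (tens a munit) a;
  rho_iso : forall a, is_iso (rho a);
  rho_nat : forall a a' (f : hom a a'),
      comp (rho a') (tensm f (idm munit)) = comp f (rho a);
  beta : forall a b, hom (tens a b) (tens b a);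
  beta_nat : forall a a' b b' (f : hom a a') (g : hom b b'),
      comp (beta a' b') (tensm f g) = comp (tensm g f) (beta a b);
  pentagon : forall a b c d,
      comp (alpha a b (tens c d)) (alpha (tens a b) c d)
      = comp (tensm (idm a) (alpha b c d))
             (comp (alpha a (tens b c) d) (tensm (alpha a b c) (idm d)));
  triangle : forall a b,
      comp (tensm (idm a) (lambda b)) (alpha a munit b) = tensm (rho a) (idm b);
  hexagon : forall a b c,
      comp (alpha b c a) (comp (beta a (tens b c)) (alpha a b c))
      = comp (tensm (idm b) (beta a c))
             (comp (alpha b a c) (tensm (beta a b) (idm c)));
  symmetry : forall a b, comp (beta b a) (beta a b) = idm (tens a b)
}.

Record Bicat := {
  bobj : Type;
  h1 : bobj -> bobj -> Type;
  h2 : forall a b, h1 a b -> h1 a b -> Type;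
  id2 : forall a b (f : h1 a b), h2 f f;
  vcomp : forall a b (f g h : h1 a b), h2 g h -> h2 f g -> h2 f h;
  id1 : forall a, h1 a a;
  hcomp1 : forall a b c, h1 b c -> h1 a b -> h1 a c;
  hcomp2 : forall a b c (g g' : h1 b c) (f f' : h1 a b),
      h2 g g' -> h2 f f' -> h2 (hcomp1 g f) (hcomp1 g' f');
  bassoc : forall a b c d (h : h1 c d) (g : h1 b c) (f : h1 a b),
      h2 (hcomp1 (hcomp1 h g) f) (hcomp1 h (hcomp1 g f));
  blunit : forall a b (f : h1 a b), h2 (hcomp1 (id1 b) f) f;
  brunit : forall a b (f : h1 a b), h2 (hcomp1 f (id1 a)) f
}.
Arguments h2 {_ _ _} _ _.
Arguments id2 {_ _ _} _.
Arguments vcomp {_ _ _ _ _ _} _ _.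
Arguments id1 {_} _.
Arguments hcomp1 {_ _ _ _} _ _.
Arguments hcomp2 {_ _ _ _ _ _ _ _} _ _.
Arguments bassoc {_ _ _ _ _} _ _ _.
Arguments blunit {_ _ _} _.
Arguments brunit {_ _ _} _.

Definition inv2 (B : Bicat) a b (f g : @h1 B a b) (t : h2 f g) : Prop :=
  exists u : h2 g f, vcomp u t = id2 f /\ vcomp t u = id2 g.

(* Facts, valid in any bicategory, guaranteeing that the invertible
   2-cells form a sub-bicategory. *)
Record PithClosed (B : Bicat) : Prop := {
  pc_id : forall a b (f : @h1 B a b), inv2 (id2 f);
  pc_v : forall a b (f g h : @h1 B a b) (t : h2 g h) (s : h2 f g),
      inv2 t -> inv2 s -> inv2 (vcomp t s);
  pc_h : forall a b c (g g' : @h1 B b c) (f f' : @h1 B a b) (t : h2 g g') (s : h2 f f'),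
      inv2 t -> inv2 s -> inv2 (hcomp2 t s);
  pc_assoc : forall a b c d (h : @h1 B c d) (g : @h1 B b c) (f : @h1 B a b),
      inv2 (bassoc h g f);
  pc_lunit : forall a b (f : @h1 B a b), inv2 (blunit f);
  pc_runit : forall a b (f : @h1 B a b), inv2 (brunit f)
}.

Definition Pith (B : Bicat) (H : PithClosed B) : Bicat := {|
  bobj := bobj B;
  h1 := @h1 B;
  h2 := fun a b f g => { t : h2 f g | inv2 t };
  id2 := fun a b f => exist _ (id2 f) (pc_id H f);
  vcomp := fun a b f g h t s =>
             exist _ (vcomp (proj1_sig t) (proj1_sig s))
                   (pc_v H (proj2_sig t) (proj2_sig s));
  id1 := @id1 B;
  hcomp1 := @hcomp1 B;
  hcomp2 := fun a b c g g' f f' t s =>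
             exist _ (hcomp2 (proj1_sig t) (proj1_sig s))
                   (pc_h H (proj2_sig t) (proj2_sig s));
  bassoc := fun a b c d h g f => exist _ (bassoc h g f) (pc_assoc H h g f);
  blunit := fun a b f => exist _ (blunit f) (pc_lunit H f);
  brunit := fun a b f => exist _ (brunit f) (pc_runit H f)
|}.

Record Pseudofunctor (B D : Bicat) (F0 : bobj B -> bobj D)
    (F1 : forall {a b}, @h1 B a b -> @h1 D (F0 a) (F0 b)) := {
  F2 : forall a b (f g : @h1 B a b), h2 f g -> h2 (F1 f) (F1 g);
  F2_id : forall a b (f : @h1 B a b), F2 (id2 f) = id2 (F1 f);
  F2_comp : forall a b (f g h : @h1 B a b) (t : h2 g h) (s : h2 f g),
      F2 (vcomp t s) = vcomp (F2 t) (F2 s);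
  Fc : forall a b c (g : @h1 B b c) (f : @h1 B a b),
      h2 (hcomp1 (F1 g) (F1 f)) (F1 (hcomp1 g f));
  Fc_inv : forall a b c (g : @h1 B b c) (f : @h1 B a b), inv2 (Fc g f);
  Fc_nat : forall a b c (g g' : @h1 B b c) (f f' : @h1 B a b)
      (t : h2 g g') (s : h2 f f'),
      vcomp (Fc g' f') (hcomp2 (F2 t) (F2 s)) = vcomp (F2 (hcomp2 t s)) (Fc g f);
  Fu : forall a, h2 (id1 (F0 a)) (F1 (id1 a));
  Fu_inv : forall a, inv2 (Fu a);
  F_assoc : forall a b c d (h : @h1 B c d) (g : @h1 B b c) (f : @h1 B a b),
      vcomp (F2 (bassoc h g f))
            (vcomp (Fc (hcomp1 h g) f) (hcomp2 (Fc h g) (id2 (F1 f))))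
      = vcomp (Fc h (hcomp1 g f))
            (vcomp (hcomp2 (id2 (F1 h)) (Fc g f)) (bassoc (F1 h) (F1 g) (F1 f)));
  F_lunit : forall a b (f : @h1 B a b),
      vcomp (F2 (blunit f)) (vcomp (Fc (id1 b) f) (hcomp2 (Fu b) (id2 (F1 f))))
      = blunit (F1 f);
  F_runit : forall a b (f : @h1 B a b),
      vcomp (F2 (brunit f)) (vcomp (Fc f (id1 a)) (hcomp2 (id2 (F1 f)) (Fu a)))
      = brunit (F1 f)
}.

Section CatBicat.

Definition idF (C : Category) : Functor C C.
Proof.
refine {| fobj := fun a => a; fmap := fun a b f => f |}; by [].
Defined.

Definition compF (C D E : Category) (G : Functor D E) (F : Functor C D) :
  Functor C E.
Proof.
refine {| fobj := fun a => G (F a); fmap := fun a b f => fmap G (fmap F f) |}.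
- by move=> a; rewrite !fmap_id.
- by move=> a b c g f; rewrite !fmap_comp.
Defined.

Definition idN (C D : Category) (F : Functor C D) : NatTrans F F.
Proof.
refine {| ntc := fun a => idm (F a) |}.
by move=> a b f; rewrite comp_id_l comp_id_r.
Defined.

Definition vcompN (C D : Category) (F G H : Functor C D)
  (t : NatTrans G H) (s : NatTrans F G) : NatTrans F H.
Proof.
refine {| ntc := fun a => comp (t a) (s a) |}.
by move=> a b f; rewrite comp_assoc ntnat -comp_assoc ntnat comp_assoc.
Defined.

Definition hcompN (C D E : Category) (G G' : Functor D E) (F F' : Functor C D)
  (t : NatTrans G G') (s : NatTrans F F') : NatTrans (compF G F) (compF G' F').
Proof.
refine (@Build_NatTrans _ _ (compF G F) (compF G' F') (fun a => comp (t (F' a)) (fmap G (s a))) _).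
move=> a b f /=.
rewrite comp_assoc ntnat -!comp_assoc -!fmap_comp ntnat.
done.
Defined.

Definition assocN (C D E F : Category) (H : Functor E F) (G : Functor D E)
  (K : Functor C D) : NatTrans (compF (compF H G) K) (compF H (compF G K)).
Proof.
refine (@Build_NatTrans _ _ (compF (compF H G) K) (compF H (compF G K)) (fun a => idm (H (G (K a)))) _).
by move=> a b f /=; rewrite comp_id_l comp_id_r.
Defined.

Definition lunitN (C D : Category) (F : Functor C D) :
  NatTrans (compF (idF D) F) F.
Proof.
refine (@Build_NatTrans _ _ (compF (idF D) F) F (fun a => idm (F a)) _).
by move=> a b f /=; rewrite comp_id_l comp_id_r.
Defined.

Definition runitN (C D : Category) (F : Functor C D) :
  NatTrans (compF F (idF C)) F.
Proof.
refine (@Build_NatTrans _ _ (compF F (idF C)) F (fun a => idm (F a)) _).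
by move=> a b f /=; rewrite comp_id_l comp_id_r.
Defined.

End CatBicat.

Definition Cat : Bicat := {|
  bobj := Category;
  h1 := Functor;
  h2 := @NatTrans;
  id2 := @idN;
  vcomp := @vcompN;
  id1 := idF;
  hcomp1 := @compF;
  hcomp2 := @hcompN;
  bassoc := @assocN;
  blunit := @lunitN;
  brunit := @runitN
|}.

Definition ProdCat (C : Category) (J : Type) : Category.
Proof.
refine {| ob := J -> C;
          hom := fun x y => forall j, hom (x j) (y j);
          idm := fun x j => idm (x j);
          comp := fun x y z g f j => comp (g j) (f j) |}.
- by move=> a b c d h g f; apply: functional_extensionality_dep => j; rewrite comp_assoc.
- by move=> a b f; apply: functional_extensionality_dep => j; rewrite comp_id_l.
- by move=> a b f; apply: functional_extensionality_dep => j; rewrite comp_id_r.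
Defined.

Definition pullF (C : Category) (A J : Type) (f : A -> J) :
  Functor (ProdCat C J) (ProdCat C A).
Proof.
refine {| fobj := fun (x : ProdCat C J) => (fun a => x (f a)) : ProdCat C A;
          fmap := fun x y m => (fun a => m (f a)) |}; by [].
Defined.

Section Tensor.
Variables (C : Category) (M : SymMonoidal C) (A : Type).

Fixpoint tensL (x : A -> C) (s : seq A) : C :=
  match s with
  | [::] => munit M
  | a :: s' => match s' with
               | [::] => x a
               | _ :: _ => tens M (x a) (tensL x s')
               end
  end.

Fixpoint tensLm (x y : A -> C) (m : forall a, hom (x a) (y a)) (s : seq A) :
  hom (tensL x s) (tensL y s) :=
  match s with
  | [::] => idm (munit M)
  | a :: s' =>
      (match s' as s0
         return hom (tensL x s0) (tensL y s0) ->
                hom (tensL x (a :: s0)) (tensL y (a :: s0)) with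
       | [::] => fun _ => m a
       | _ :: _ => fun r => tensm M (m a) r
       end) (tensLm m s')
  end.

Lemma tensLm_id (x : A -> C) s : tensLm (fun a => idm (x a)) s = idm (tensL x s).
Proof.
elim: s => [|a [|b s] IH] //=.
by move: IH => /= ->; rewrite tensm_id.
Qed.

Lemma tensLm_comp (x y z : A -> C) (g : forall a, hom (y a) (z a))
  (f : forall a, hom (x a) (y a)) s :
  tensLm (fun a => comp (g a) (f a)) s = comp (tensLm g s) (tensLm f s).
Proof.
elim: s => [|a [|b s] IH] /=; first by rewrite comp_id_l.
  by [].
by move: IH => /= ->; rewrite tensm_comp.
Qed.

End Tensor.

Definition fibre (A : finType) (K : eqType) (g : A -> K) (k : K) : seq A :=
  [seq a <- enum A | g a == k].

Definition pushF (C : Category) (M : SymMonoidal C) (A : finType) (K : finType)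
  (g : A -> K) : Functor (ProdCat C A) (ProdCat C K).
Proof.
refine {| fobj := fun (x : ProdCat C A) =>
                    (fun k => tensL M x (fibre g k)) : ProdCat C K;
          fmap := fun x y m => (fun k => tensLm M m (fibre g k)) |}.
- by move=> x; apply: functional_extensionality_dep => k; rewrite /= tensLm_id.
- by move=> x y z g' f; apply: functional_extensionality_dep => k;
     rewrite /= tensLm_comp.
Defined.

Record Span (J K : finType) := {
  apex : finType;
  sl : apex -> J;
  sr : apex -> K
}.
Arguments apex {_ _} _.
Arguments sl {_ _} _ _.
Arguments sr {_ _} _ _.

Definition SpanMor (J K : finType) (S T : Span J K) :=
  { m : {ffun apex S -> apex T} |
    [forall x, (sl T (m x) == sl S x) && (sr T (m x) == sr S x)] }.

Definition smap (J K : finType) (S T : Span J K) (t : SpanMor S T) :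
  apex S -> apex T := fun x => proj1_sig t x.

Lemma smapP (J K : finType) (S T : Span J K) (t : SpanMor S T) x :
  sl T (smap t x) = sl S x /\ sr T (smap t x) = sr S x.
Proof.
rewrite /smap; case: t => m /= /forallP /(_ x) /andP [/eqP h1 /eqP h2]; by split.
Qed.

Lemma smor_eq (J K : finType) (S T : Span J K) (t u : SpanMor S T) :
  (forall x, smap t x = smap u x) -> t = u.
Proof.
case: t u => [m hm] [n hn] /= H.
have E : m = n by apply/ffunP => x; exact: H.
subst n; congr exist; exact: bool_irrelevance.
Qed.

Definition mkSpanMor (J K : finType) (S T : Span J K) (m : apex S -> apex T)
  (hl : forall x, sl T (m x) = sl S x) (hr : forall x, sr T (m x) = sr S x) :
  SpanMor S T.
Proof.
exists [ffun x => m x].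
apply/forallP => x; rewrite ffunE hl hr; by rewrite !eqxx.
Defined.

Lemma smap_mk (J K : finType) (S T : Span J K) m hl hr x :
  smap (@mkSpanMor J K S T m hl hr) x = m x.
Proof. by rewrite /smap /= ffunE. Qed.

Definition spid (J : finType) : Span J J := {| apex := J; sl := id; sr := id |}.

Definition pbT (J K L : finType) (T : Span K L) (S : Span J K) : finType :=
  {p : apex S * apex T | sr S p.1 == sl T p.2}.

Definition spcomp (J K L : finType) (T : Span K L) (S : Span J K) : Span J L :=
  {| apex := pbT T S;
     sl := fun p => sl S (val p).1;
     sr := fun p => sr T (val p).2 |}.

Definition sp_id2 (J K : finType) (S : Span J K) : SpanMor S S :=
  @mkSpanMor J K S S id (fun _ => erefl) (fun _ => erefl).

Definition sp_vcomp (J K : finType) (S T U : Span J K)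
  (t : SpanMor T U) (s : SpanMor S T) : SpanMor S U.
Proof.
refine (@mkSpanMor J K S U (fun x => smap t (smap s x)) _ _).
- by move=> x; rewrite (smapP t _).1 (smapP s _).1.
- by move=> x; rewrite (smapP t _).2 (smapP s _).2.
Defined.

Definition sp_hmap (J K L : finType) (T T' : Span K L) (S S' : Span J K)
  (t : SpanMor T T') (s : SpanMor S S') (p : pbT T S) : pbT T' S'.
Proof.
refine (exist _ (smap s (val p).1, smap t (val p).2) _).
by rewrite /= (smapP s _).2 (smapP t _).1; exact: (valP p).
Defined.

Definition sp_hcomp2 (J K L : finType) (T T' : Span K L) (S S' : Span J K)
  (t : SpanMor T T') (s : SpanMor S S') :
  SpanMor (spcomp T S) (spcomp T' S').
Proof.
refine (@mkSpanMor J L (spcomp T S) (spcomp T' S') (sp_hmap t s) _ _).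
- by move=> p; rewrite /= (smapP s _).1.
- by move=> p; rewrite /= (smapP t _).2.
Defined.

Definition sp_assoc_map (I J K L : finType) (U : Span K L) (T : Span J K)
  (S : Span I J) (p : pbT (spcomp U T) S) : pbT U (spcomp T S).
Proof.
case: p => [[s tu] /= h].
refine (exist _ (exist _ (s, (val tu).1) h, (val tu).2) _).
exact: (valP tu).
Defined.

Definition sp_assoc (I J K L : finType) (U : Span K L) (T : Span J K)
  (S : Span I J) : SpanMor (spcomp (spcomp U T) S) (spcomp U (spcomp T S)).
Proof.
refine (@mkSpanMor I L (spcomp (spcomp U T) S) (spcomp U (spcomp T S))
          (@sp_assoc_map I J K L U T S) _ _).
- by case=> [[s [[t u] htu]] h].
- by case=> [[s [[t u] htu]] h].
Defined.

Definition sp_lunit (J K : finType) (S : Span J K) :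
  SpanMor (spcomp (spid K) S) S.
Proof.
refine (@mkSpanMor J K (spcomp (spid K) S) S (fun p => (val p).1) _ _).
- by [].
- by case=> [[s k] /= /eqP].
Defined.

Definition sp_runit (J K : finType) (S : Span J K) :
  SpanMor (spcomp S (spid J)) S.
Proof.
refine (@mkSpanMor J K (spcomp S (spid J)) S (fun p => (val p).2) _ _).
- by case=> [[j s] /= /eqP].
- by [].
Defined.

Definition SpanFin : Bicat := {|
  bobj := finType;
  h1 := Span;
  h2 := @SpanMor;
  id2 := @sp_id2;
  vcomp := @sp_vcomp;
  id1 := spid;
  hcomp1 := @spcomp;
  hcomp2 := @sp_hcomp2;
  bassoc := @sp_assoc;
  blunit := @sp_lunit;
  brunit := @sp_runit
|}.

Definition sp_assoc_inv_map (I J K L : finType) (U : Span K L) (T : Span J K)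
  (S : Span I J) (q : pbT U (spcomp T S)) : pbT (spcomp U T) S.
Proof.
case: q => [[[[s t] hst] u] /= h].
exact: (exist _ (s, exist _ (t, u) h) hst).
Defined.

Lemma sp_bij_inv2 (J K : finType) (S T : Span J K) (t : SpanMor S T)
  (g : apex T -> apex S) :
  cancel (smap t) g -> cancel g (smap t) -> @inv2 SpanFin J K S T t.
Proof.
move=> c1 c2.
have hl : forall y, sl S (g y) = sl T y.
  by move=> y; rewrite -{2}(c2 y) (smapP t _).1.
have hr : forall y, sr S (g y) = sr T y.
  by move=> y; rewrite -{2}(c2 y) (smapP t _).2.
exists (@mkSpanMor J K T S g hl hr); split; apply: smor_eq => x /=;
  rewrite /sp_id2 /sp_vcomp !smap_mk //.
Qed.

Lemma sp_inv2_bij (J K : finType) (S T : Span J K) (t : SpanMor S T) :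
  @inv2 SpanFin J K S T t ->
  exists g, cancel (smap t) g /\ cancel g (smap t).
Proof.
case=> u [e1 e2]; exists (smap u); split => x.
- by have := congr1 (fun w => smap w x) e1; rewrite /= /sp_vcomp /sp_id2 !smap_mk.
- by have := congr1 (fun w => smap w x) e2; rewrite /= /sp_vcomp /sp_id2 !smap_mk.
Qed.

Lemma PithClosed_SpanFin : PithClosed SpanFin.
Proof.
split.
- move=> a b f; apply: (@sp_bij_inv2 a b f f _ id) => x /=;
    by rewrite /sp_id2 smap_mk.
- move=> a b f g h t s /sp_inv2_bij [u [tu ut]] /sp_inv2_bij [v [sv vs]].
  apply: (@sp_bij_inv2 a b f h _ (fun x => v (u x))) => x /=;
    rewrite /sp_vcomp smap_mk; by rewrite ?tu ?sv ?ut ?vs.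
- move=> a b c g g' f f' t s /sp_inv2_bij [u [tu ut]] /sp_inv2_bij [v [sv vs]].
  apply: (@sp_bij_inv2 a c (spcomp g f) (spcomp g' f') _
            (fun p => exist _ (v (val p).1, u (val p).2) _)).
  + by move=> p /=; rewrite -(smapP s (v _)).2 -(smapP t (u _)).1 vs ut; exact: (valP p).
  + move=> pf x; apply: val_inj => /=.
    by rewrite /sp_hcomp2 smap_mk /= sv tu; case: x => [[]].
  + move=> pf x; apply: val_inj => /=.
    by rewrite /sp_hcomp2 smap_mk /= vs ut; case: x => [[]].
- move=> a b c d h g f.
  apply: (@sp_bij_inv2 a d (spcomp (spcomp h g) f) (spcomp h (spcomp g f))
            (sp_assoc h g f) (@sp_assoc_inv_map a b c d h g f)).
  + by case=> [[s [[t u] htu]] hs]; rewrite /sp_assoc smap_mk /=;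
       apply: val_inj; congr pair; apply: val_inj.
  + by case=> [[[[s t] hst] u] hu]; rewrite /sp_assoc smap_mk /=;
       apply: val_inj; congr pair; apply: val_inj.
- move=> a b f.
  apply: (@sp_bij_inv2 a b (spcomp (spid b) f) f (sp_lunit f)
            (fun s => exist _ (s, sr f s) (eqxx _) : pbT (spid b) f)).
  + case=> [[s k] hk]; rewrite /sp_lunit smap_mk; apply: val_inj => /=.
    by rewrite (eqP hk).
  + by move=> s; rewrite /sp_lunit smap_mk.
- move=> a b f.
  apply: (@sp_bij_inv2 a b (spcomp f (spid a)) f (sp_runit f)
            (fun s => exist _ (sl f s, s) (eqxx _) : pbT f (spid a))).
  + case=> [[j s] hj]; rewrite /sp_runit smap_mk; apply: val_inj => /=.
    by move: hj => /= /eqP ->.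
  + by move=> s; rewrite /sp_runit smap_mk.
Qed.

Definition PithSpanFin : Bicat := Pith PithClosed_SpanFin.

Definition spanFunctor (C : Category) (M : SymMonoidal C) (J K : finType)
  (S : Span J K) : Functor (ProdCat C J) (ProdCat C K) :=
  compF (pushF M (sr S)) (pullF C (sl S)).

(* Main.v *)
Require Import Defs.
From mathcomp Require Import ssreflect ssrfun ssrbool eqtype ssrnat seq choice fintype finfun.
From Stdlib Require Import FunctionalExtensionality ProofIrrelevance IndefiniteDescription.

(** Over finite lists of objects of [C], call a morphism between right-bracketed tensor
    products canonical if it is built by repeatedly extracting a factor of the source with the
    symmetry and applying a given map to it.  Extractions of two different factors commute up to
    the symmetry (by the Yang-Baxter identity), so canonical morphisms compose; and when the
    factors of the source carry distinct labels, a canonical morphism is determined by the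
    matching of labels it realizes and the maps it applies.  Iterated tensor products over
    fibres are identified with right-bracketed ones by flattening, and flattening is compatible
    with canonical morphisms (the coherence theorem).  The 2-cells of the pseudofunctor are the
    canonical morphisms realizing the evident bijections of labels, and each axiom equates two
    canonical morphisms that realize the same bijection. *)

Set Implicit Arguments.
Unset Strict Implicit.
Unset Printing Implicit Defensive.

Local Notation "g ∘ f" := (Defs.comp g f) (at level 45, right associativity).

(** * Consequences of the symmetric monoidal axioms *)

Section Coherence.
Variables (C : Category) (M : SymMonoidal C).

Local Notation "a ⊗ b" := (tens M a b) (at level 38, right associativity).
Local Notation "f ⊠ g" := (tensm M f g) (at level 38, right associativity).
Local Notation "1" := (idm _).
Local Notation α := (alpha M _ _ _).
Local Notation β := (beta M _ _).
Local Notation λ := (lambda M _).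
Local Notation ρ := (rho M _).

Lemma compA (a b c d : C) (h : hom c d) (g : hom b c) (f : hom a b) :
  (h ∘ g) ∘ f = h ∘ g ∘ f.
Proof. by rewrite comp_assoc. Qed.

Lemma reassoc (a b c : C) (g : hom b c) (f : hom a b) (h : hom a c) :
  g ∘ f = h -> forall d (k : hom d a), g ∘ f ∘ k = h ∘ k.
Proof. by move=> <- d k; rewrite compA. Qed.

Lemma reassoc2 (a b b' c : C) (g : hom b c) (f : hom a b) (g' : hom b' c) (f' : hom a b') :
  g ∘ f = g' ∘ f' -> forall d (k : hom d a), g ∘ f ∘ k = g' ∘ f' ∘ k.
Proof. by move=> E d k; rewrite -!compA E. Qed.

Lemma reassoc3 (a b b' c : C) (g : hom b b') (g' : hom b' c) (f : hom a b) (h : hom a c) :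
  g' ∘ g ∘ f = h -> forall d (k : hom d a), g' ∘ g ∘ f ∘ k = h ∘ k.
Proof. by move=> <- d k; rewrite !compA. Qed.

Lemma is_iso_id (a : C) : is_iso (idm a).
Proof. by exists 1; rewrite comp_id_l. Qed.

Lemma is_iso_comp (a b c : C) (g : hom b c) (f : hom a b) :
  is_iso g -> is_iso f -> is_iso (g ∘ f).
Proof.
move=> [g' [Hg1 Hg2]] [f' [Hf1 Hf2]]; exists (f' ∘ g'); split.
  by rewrite compA (reassoc Hg1) comp_id_l.
by rewrite compA (reassoc Hf2) comp_id_l.
Qed.

Lemma is_iso_tens (a b a' b' : C) (f : hom a a') (g : hom b b') :
  is_iso f -> is_iso g -> is_iso (f ⊠ g).
Proof.
move=> [f' [Hf1 Hf2]] [g' [Hg1 Hg2]]; exists (f' ⊠ g').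
by rewrite -!tensm_comp Hf1 Hf2 Hg1 Hg2 !tensm_id.
Qed.

Lemma iso_epi (a b c : C) (f : hom a b) (g h : hom b c) :
  is_iso f -> g ∘ f = h ∘ f -> g = h.
Proof.
by move=> [f' [_ Hf]] E; rewrite -(comp_id_r g) -(comp_id_r h) -Hf !comp_assoc E.
Qed.

Lemma iso_mono (a b c : C) (f : hom b c) (g h : hom a b) :
  is_iso f -> f ∘ g = f ∘ h -> g = h.
Proof.
by move=> [f' [Hf _]] E; rewrite -(comp_id_l g) -(comp_id_l h) -Hf -!comp_assoc E.
Qed.

(** [is_iso] only asserts that an inverse exists; a choice principle turns it into a morphism that
    can enter definitions. *)
Definition inv (a b : C) (f : hom a b) (H : is_iso f) : hom b a :=
  proj1_sig (constructive_indefinite_description _ H).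

Lemma inv_l (a b : C) (f : hom a b) (H : is_iso f) : inv H ∘ f = 1.
Proof. by rewrite /inv; case: constructive_indefinite_description => g []. Qed.

Lemma inv_r (a b : C) (f : hom a b) (H : is_iso f) : f ∘ inv H = 1.
Proof. by rewrite /inv; case: constructive_indefinite_description => g []. Qed.

Lemma is_iso_inv (a b : C) (f : hom a b) (H : is_iso f) : is_iso (inv H).
Proof. by exists f; rewrite inv_l inv_r. Qed.

Definition ainv (a b c : C) : hom (a ⊗ b ⊗ c) ((a ⊗ b) ⊗ c) := inv (alpha_iso M a b c).
Definition rinv (a : C) : hom a (a ⊗ munit M) := inv (rho_iso M a).

Lemma ainvK (a b c : C) : ainv a b c ∘ α = 1. Proof. exact: inv_l. Qed.
Lemma alphaK (a b c : C) : α ∘ ainv a b c = 1. Proof. exact: inv_r. Qed.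
Lemma rinvK (a : C) : rinv a ∘ ρ = 1. Proof. exact: inv_l. Qed.
Lemma rhoK (a : C) : ρ ∘ rinv a = 1. Proof. exact: inv_r. Qed.

Lemma tens_1_comp (a b b' b'' : C) (g : hom b' b'') (f : hom b b') :
  idm a ⊠ (g ∘ f) = (1 ⊠ g) ∘ (1 ⊠ f).
Proof. by rewrite -tensm_comp comp_id_l. Qed.

Lemma tens_comp_1 (a b b' b'' : C) (g : hom b' b'') (f : hom b b') :
  (g ∘ f) ⊠ idm a = (g ⊠ 1) ∘ (f ⊠ 1).
Proof. by rewrite -tensm_comp comp_id_l. Qed.

(** Naturality of the invertible [λ] recovers [f] from [1 ⊠ f], so unit identities may be checked
    after tensoring with the unit. *)
Lemma tens_1_inj (a b : C) (f g : hom a b) : idm (munit M) ⊠ f = 1 ⊠ g -> f = g.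
Proof.
move=> E; apply: (iso_epi (lambda_iso M a)).
by rewrite -!lambda_nat E.
Qed.

Lemma tens_inj_1 (a b : C) (f g : hom a b) : f ⊠ idm (munit M) = g ⊠ 1 -> f = g.
Proof.
move=> E; apply: (iso_epi (rho_iso M a)).
by rewrite -!rho_nat E.
Qed.

(** Kelly's argument: after tensoring with the unit and composing with two associators, the
    pentagon, the triangle and the naturality of [α] identify both sides. *)
Lemma lambda_alpha (a b : C) : λ ∘ alpha M (munit M) a b = λ ⊠ 1.
Proof.
apply: tens_1_inj.
apply: (@iso_epi _ _ _ (α ∘ (α ⊠ 1))).
  apply: is_iso_comp (alpha_iso _ _ _ _) _.
  exact: is_iso_tens (alpha_iso _ _ _ _) (is_iso_id _).
rewrite tens_1_comp compA -pentagon -compA triangle -tensm_id -alpha_nat.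
by rewrite -triangle -!compA -alpha_nat !compA -tensm_comp comp_id_l.
Qed.

Lemma rho_alpha (a b : C) : (1 ⊠ ρ) ∘ alpha M a b (munit M) = ρ.
Proof.
apply: tens_inj_1.
apply: (iso_mono (alpha_iso M _ _ _)).
rewrite tens_comp_1 -compA alpha_nat compA -triangle tens_1_comp !compA -pentagon.
by rewrite -triangle -compA -alpha_nat tensm_id compA.
Qed.

(** The hexagon at [a], unit, unit, read after tensoring with the unit; [lambda_alpha] and the
    triangle remove the associators. *)
Lemma lambda_beta (a : C) : λ ∘ beta M a (munit M) = ρ.
Proof.
apply: tens_inj_1.
apply: (@iso_mono _ _ _ (beta M a (munit M))).
  by exists (beta M (munit M) a); rewrite !symmetry.
rewrite tens_comp_1 -lambda_alpha -[in LHS]compA -[in LHS]compA -[in LHS]lambda_nat.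
rewrite !compA -hexagon (reassoc (lambda_alpha _ _)) -compA -beta_nat compA.
by rewrite triangle.
Qed.

Lemma rho_beta (a : C) : ρ ∘ beta M (munit M) a = λ.
Proof. by rewrite -lambda_beta compA symmetry comp_id_r. Qed.

(* Locked so that rewriting with [compA] does not unfold it. *)
Definition sg (a b c : C) : hom (a ⊗ b ⊗ c) (b ⊗ a ⊗ c) :=
  locked (α ∘ (β ⊠ 1) ∘ ainv a b c).

Lemma sgE (a b c : C) : sg a b c = α ∘ (β ⊠ 1) ∘ ainv a b c.
Proof. by rewrite /sg -lock. Qed.

Lemma ainv_nat (a a' b b' c c' : C) (f : hom a a') (g : hom b b') (h : hom c c') :
  ainv a' b' c' ∘ (f ⊠ g ⊠ h) = ((f ⊠ g) ⊠ h) ∘ ainv a b c.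
Proof.
apply: (iso_epi (alpha_iso M _ _ _)).
by rewrite !compA ainvK -alpha_nat -compA ainvK comp_id_l comp_id_r.
Qed.

Lemma sg_nat (a a' b b' c c' : C) (f : hom a a') (g : hom b b') (h : hom c c') :
  sg a' b' c' ∘ (f ⊠ g ⊠ h) = (g ⊠ f ⊠ h) ∘ sg a b c.
Proof.
rewrite !sgE !compA ainv_nat (reassoc (esym (tensm_comp _ _ _ _ _))) beta_nat.
by rewrite comp_id_l -[in LHS](comp_id_r h) tensm_comp -[in RHS]compA -alpha_nat !compA.
Qed.

Lemma sgK (a b c : C) : sg b a c ∘ sg a b c = 1.
Proof.
rewrite !sgE !compA (reassoc (ainvK _ _ _)) comp_id_l.
by rewrite (reassoc (esym (tensm_comp _ _ _ _ _))) symmetry comp_id_l tensm_id comp_id_l alphaK.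
Qed.

Lemma is_iso_sg (a b c : C) : is_iso (sg a b c).
Proof. by exists (sg b a c); rewrite !sgK. Qed.

Lemma lambda_sg (a c : C) : (1 ⊠ λ) ∘ sg (munit M) a c = λ.
Proof.
rewrite !sgE -compA triangle -compA -tensm_comp rho_beta comp_id_l -lambda_alpha.
by rewrite compA alphaK comp_id_r.
Qed.

Lemma sg_lambda (a c : C) : λ ∘ sg a (munit M) c = 1 ⊠ λ.
Proof. by rewrite -lambda_sg compA sgK comp_id_r. Qed.

(** The pentagon, rearranged by inverting three of its five associators. *)
Lemma ainv_pentagon (a b c d : C) :
  α ∘ (ainv a b c ⊠ idm d) ∘ ainv _ _ _ = ainv _ _ _ ∘ (1 ⊠ α).
Proof.
apply: (@iso_epi _ _ _ (α ∘ (α ⊠ 1))).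
  apply: is_iso_comp (alpha_iso _ _ _ _) _.
  exact: is_iso_tens (alpha_iso _ _ _ _) (is_iso_id _).
rewrite !compA (reassoc (ainvK _ _ _)) comp_id_l -tensm_comp ainvK comp_id_l tensm_id comp_id_r.
by rewrite -pentagon -compA ainvK comp_id_l.
Qed.

(** The hexagon, restated for [sg]; the pentagon accounts for the remaining factor [u]. *)
Lemma alpha_sg (s b t u : C) :
  α ∘ sg s (b ⊗ t) u = (1 ⊠ sg s t u) ∘ sg s b (t ⊗ u) ∘ (1 ⊠ α).
Proof.
have hex : alpha M b t s ∘ beta M s (b ⊗ t) =
    (1 ⊠ beta M s t) ∘ α ∘ (beta M s b ⊠ 1) ∘ ainv s b t.
  apply: (iso_epi (alpha_iso M s b t)).
  by rewrite !compA ainvK comp_id_r hexagon.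
rewrite {1}sgE -compA pentagon !compA.
rewrite (reassoc (esym (tens_comp_1 _ _ _))) hex !tens_comp_1 !compA (reassoc2 (alpha_nat _ _ _ _)).
rewrite {1}sgE !tens_1_comp !compA; congr (_ ∘ _ ∘ _).
apply: (@iso_mono _ _ _ (1 ⊠ alpha M s t u)).
  exact: is_iso_tens (is_iso_id _) (alpha_iso _ _ _ _).
rewrite -[in RHS]compA -tens_1_comp alphaK tensm_id comp_id_l.
have -> : forall z (k : hom z _), (idm b ⊠ alpha M s t u) ∘ α ∘ (α ⊠ 1) ∘ k = α ∘ α ∘ k.
  by move=> z k; rewrite -[RHS]compA pentagon ?compA.
rewrite (reassoc2 (alpha_nat _ _ _ _)) ainv_pentagon tensm_id.
by rewrite sgE !compA.
Qed.

(** The second hexagon, obtained by inverting [alpha_sg] with [sgK]. *)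
Lemma sg_alpha (c s a r : C) :
  sg c a (s ⊗ r) ∘ (1 ⊠ sg s a r) ∘ α = (1 ⊠ α) ∘ sg (c ⊗ s) a r.
Proof.
apply: (iso_epi (is_iso_sg a (c ⊗ s) r)).
rewrite !compA sgK comp_id_r alpha_sg.
rewrite (reassoc (esym (tens_1_comp _ _ _))) sgK tensm_id comp_id_l.
by rewrite (reassoc (sgK _ _ _)) comp_id_l.
Qed.

(** Only the first two factors are exchanged, so the pentagon and the naturality of [α] suffice. *)
Lemma sg_alpha2 (c a r t : C) :
  sg c a (r ⊗ t) ∘ (1 ⊠ α) ∘ α = (1 ⊠ α) ∘ α ∘ (sg c a r ⊠ idm t).
Proof.
rewrite !sgE !compA.
rewrite (reassoc (esym (ainv_pentagon _ _ _ _))) !compA ainvK comp_id_r.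
rewrite -tensm_id (reassoc2 (esym (alpha_nat _ _ _ _))) !tens_comp_1.
by rewrite (reassoc (pentagon _ _ _ _ _)) !compA.
Qed.

(* Slide [β] through [sg a], using that [sg a] is natural in, and by [alpha_sg]
   compatible with, the tensor product [b ⊗ c]. *)
Lemma yang_baxter (a b c x : C) :
  (1 ⊠ sg a b x) ∘ sg a c (b ⊗ x) ∘ (1 ⊠ sg b c x)
  = sg b c (a ⊗ x) ∘ (1 ⊠ sg a c x) ∘ sg a b (c ⊗ x).
Proof.
have H b' c' : (1 ⊠ sg a c' x) ∘ sg a b' (c' ⊗ x) = α ∘ sg a (b' ⊗ c') x ∘ (1 ⊠ ainv _ _ _).
  by rewrite -[RHS]compA alpha_sg !compA -tens_1_comp alphaK tensm_id comp_id_r.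
rewrite H -[in LHS]compA H !compA (sgE b c x) !tens_1_comp.
rewrite (reassoc (esym (tens_1_comp _ _ _))) ainvK tensm_id comp_id_l.
rewrite (reassoc2 (sg_nat _ _ _)) (sgE b c (a ⊗ x)) !compA (reassoc (ainvK _ _ _)) comp_id_l.
by rewrite tensm_id.
Qed.

(** * Extractions and canonical morphisms *)

Fixpoint ten (A : Type) (x : A -> C) (s : seq A) : C :=
  if s is a :: s' then x a ⊗ ten x s' else munit M.

(* [Ext a r s e]: [e] is the canonical map pulling one occurrence of [a] out of [s] to the
   front, leaving [r].  Using a relation on [r] and [e] avoids transports along equalities
   between lists. *)
Inductive Ext (A : Type) (x : A -> C) :
  forall a r s, hom (ten x s) (x a ⊗ ten x r) -> Prop :=
| Ext_head a s : Ext (idm (ten x (a :: s)))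
| Ext_tail a c r s (e : hom (ten x s) (x a ⊗ ten x r)) :
    Ext e -> @Ext A x a (c :: r) (c :: s) (sg _ _ _ ∘ (1 ⊠ e)).

(* [Can R s t f]: [f] is a canonical map that matches the factors of [ten x s] with those of
   [ten y t], applying to each matched pair of factors a map allowed by [R]. *)
Inductive Can (A B : Type) (x : A -> C) (y : B -> C)
    (R : forall a b, hom (x a) (y b) -> Prop) :
  forall s t, hom (ten x s) (ten y t) -> Prop :=
| Can_nil : @Can A B x y R [::] [::] 1
| Can_cons a b r s t (e : hom (ten x s) (x a ⊗ ten x r)) (φ : hom (x a) (y b))
    (g : hom (ten x r) (ten y t)) :
    Ext e -> R a b φ -> Can R g -> @Can A B x y R s (b :: t) ((φ ⊠ g) ∘ e).

(** The type of [e] mentions the list that is being inverted, so plain inversion would leave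
    equalities between dependent pairs. The motive [P] ranges over the indices that vary, and the
    match is on the list. *)
Lemma Ext_cons_inv (A : Type) (x : A -> C) c s
    (P : forall a r, hom (ten x (c :: s)) (x a ⊗ ten x r) -> Prop) :
  P c s 1 ->
  (forall a r e, @Ext A x a r s e -> P a (c :: r) (sg _ _ _ ∘ (1 ⊠ e))) ->
  forall a r e, @Ext A x a r (c :: s) e -> P a r e.
Proof.
move=> P0 PS a r e E; move: P P0 PS.
refine (match E in @Ext _ _ a r s' e return
  match s' as s' return hom (ten x s') (x a ⊗ ten x r) -> Prop with
  | [::] => fun=> True
  | c :: s => fun e => forall P : forall a r, hom (ten x (c :: s)) (x a ⊗ ten x r) -> Prop,
      P c s 1 ->
      (forall a r e, @Ext A x a r s e -> P a (c :: r) (sg _ _ _ ∘ (1 ⊠ e))) -> P a r e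
  end e with Ext_head _ _ => _ | Ext_tail _ _ _ _ _ E' => _ end).
  by move=> P P0 _.
by move=> P _ PS; apply: PS.
Qed.

Lemma Ext_nil_inv (A : Type) (x : A -> C) a r e : ~ @Ext A x a r [::] e.
Proof.
suff H s (e' : hom (ten x s) (x a ⊗ ten x r)) : Ext e' -> s <> [::] by move=> /H.
by case.
Qed.

Lemma Can_cons_inv (A B : Type) (x : A -> C) (y : B -> C)
    (R : forall a b, hom (x a) (y b) -> Prop) s b t
    (P : hom (ten x s) (ten y (b :: t)) -> Prop) :
  (forall a r e φ g, @Ext A x a r s e -> R a b φ -> @Can A B x y R r t g -> P ((φ ⊠ g) ∘ e)) ->
  forall f, @Can A B x y R s (b :: t) f -> P f.
Proof.
move=> PS f E; move: P PS.
refine (match E in @Can _ _ _ _ _ s t' f return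
  match t' as t' return hom (ten x s) (ten y t') -> Prop with
  | [::] => fun=> True
  | b :: t => fun f => forall P : hom (ten x s) (ten y (b :: t)) -> Prop,
     (forall a r e φ g, @Ext A x a r s e -> R a b φ -> @Can A B x y R r t g ->
        P ((φ ⊠ g) ∘ e)) -> P f
  end f with Can_nil => I | Can_cons _ _ _ _ _ _ _ _ _ _ _ => _ end).
by move=> P; apply.
Qed.

Lemma Can_nil_inv (A B : Type) (x : A -> C) (y : B -> C)
    (R : forall a b, hom (x a) (y b) -> Prop) s
    (P : forall s, hom (ten x s) (ten y [::]) -> Prop) :
  P [::] 1 -> forall f, @Can A B x y R s [::] f -> P s f.
Proof.
move=> P0 f E; move: P P0.
refine (match E in @Can _ _ _ _ _ s t' f return
  match t' as t' return hom (ten x s) (ten y t') -> Prop with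
  | [::] => fun f => forall P : forall s, hom (ten x s) (ten y [::]) -> Prop, P [::] 1 -> P s f
  | b :: t => fun=> True
  end f with Can_nil => _ | Can_cons _ _ _ _ _ _ _ _ _ _ _ => I end).
by [].
Qed.

(** Induction on the first extraction. If one of the factors is the head, the square commutes
    trivially or because [sg] is involutive; if both lie in the tail, the Yang-Baxter identity
    reduces it to the induction hypothesis. *)
Lemma Ext_swap (A : Type) (x : A -> C) a b q r s e e1 :
  @Ext A x a r s e -> @Ext A x b q r e1 ->
  exists r' e' e1', [/\ @Ext A x b r' s e', @Ext A x a q r' e1' &
    sg _ _ _ ∘ (1 ⊠ e1) ∘ e = (1 ⊠ e1') ∘ e'].
Proof.
move=> E; elim: E b q e1 => {a r s e} [a s|a c r s e E IH] b q e1.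
  move=> E1; exists (a :: q), (sg _ _ _ ∘ (1 ⊠ e1)), 1; split.
  - exact: Ext_tail.
  - exact: Ext_head.
  - by rewrite comp_id_r tensm_id comp_id_l.
move=> E1.
move: b q e1 E1; apply: Ext_cons_inv => [|b q e1 E1].
  exists s, 1, e; split=> //; first exact: Ext_head.
  by rewrite tensm_id comp_id_l (reassoc (sgK _ _ _)) comp_id_l comp_id_r.
have [r' [e' [e1' [E' E1' H]]]] := IH _ _ _ E1.
exists (c :: r'), (sg _ _ _ ∘ (1 ⊠ e')), (sg _ _ _ ∘ (1 ⊠ e1')).
split; [exact: Ext_tail|exact: Ext_tail|].
rewrite !tens_1_comp !compA.
rewrite -!(reassoc2 (sg_nat _ _ _)) (reassoc3 (esym (yang_baxter _ _ _ _))).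
by rewrite !compA -!tens_1_comp H.
Qed.

(** Induction on [f]. If the requested factor is not the one that [f] matches first, [Ext_swap] lets
    its extraction precede the first extraction of [f]. *)
Lemma Can_Ext (A B : Type) (x : A -> C) (y : B -> C)
    (R : forall a b, hom (x a) (y b) -> Prop) s t f b q e' :
  @Can A B x y R s t f -> @Ext B y b q t e' ->
  exists a r e φ g, [/\ @Ext A x a r s e, R a b φ, @Can A B x y R r q g &
    e' ∘ f = (φ ⊠ g) ∘ e].
Proof.
move=> F; elim: F b q e' => {s t f} [b q e' E'|a0 b0 r s t e φ0 g E R0 G IH].
  by case: (Ext_nil_inv E').
apply: Ext_cons_inv => [|b q e' E'].
  by exists a0, r, e, φ0, g; rewrite comp_id_l.
have [a [r1 [e1 [φ [g1 [E1 Rφ G1 H]]]]]] := IH _ _ _ E'.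
have [r' [e2 [e1' [E2 E1' H']]]] := Ext_swap E E1.
exists a, r', e2, φ, ((φ0 ⊠ g1) ∘ e1'); split=> //; first exact: Can_cons.
rewrite !compA (reassoc (esym (tensm_comp _ _ _ _ _))) comp_id_l H.
have -> : φ0 ⊠ ((φ ⊠ g1) ∘ e1) = (φ0 ⊠ φ ⊠ g1) ∘ (1 ⊠ e1) by rewrite -tensm_comp comp_id_r.
rewrite compA (reassoc2 (sg_nat _ _ _)) H' -!compA.
by rewrite -tensm_comp comp_id_r.
Qed.

(** Induction on the second map, whose first extraction is pulled back through the first map by
    [Can_Ext]. *)
Lemma Can_comp (A B D : Type) (x : A -> C) (y : B -> C) (z : D -> C)
    (R : forall a b, hom (x a) (y b) -> Prop) (R' : forall b d, hom (y b) (z d) -> Prop)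
    (R'' : forall a d, hom (x a) (z d) -> Prop) s t u f g :
  (forall a b d φ ψ, R a b φ -> R' b d ψ -> R'' a d (ψ ∘ φ)) ->
  @Can A B x y R s t f -> @Can B D y z R' t u g -> @Can A D x z R'' s u (g ∘ f).
Proof.
move=> HR F G; elim: G s f F => {t u g} [s f|b d q t u e' ψ g' E' Rψ G IH s f F].
  apply: (@Can_nil_inv A B x y R s (fun s f => @Can A D x z R'' s [::] (idm (munit M) ∘ f))).
  by rewrite comp_id_l; apply: Can_nil.
have [a [r [e [φ [g1 [E Rφ G1 H]]]]]] := Can_Ext F E'.
rewrite compA H -compA -tensm_comp.
by apply: Can_cons E _ (IH _ _ G1); apply: HR Rφ Rψ.
Qed.

Lemma Can_weak (A B : Type) (x : A -> C) (y : B -> C)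
    (R R' : forall a b, hom (x a) (y b) -> Prop) s t f :
  (forall a b φ, R a b φ -> R' a b φ) -> @Can A B x y R s t f -> @Can A B x y R' s t f.
Proof.
move=> HR; elim=> {s t f} [|a b r s t e φ g E Rφ _ IH]; first exact: Can_nil.
by apply: Can_cons E _ IH; apply: HR.
Qed.

Lemma Can_cons0 (A B : Type) (x : A -> C) (y : B -> C)
    (R : forall a b, hom (x a) (y b) -> Prop) a b s t φ g :
  R a b φ -> @Can A B x y R s t g -> @Can A B x y R (a :: s) (b :: t) (φ ⊠ g).
Proof.
by move=> Rφ G; have := Can_cons (Ext_head x a s) Rφ G; rewrite comp_id_r.
Qed.

(** An identity is typed from [x a] to [x b] only when [a] is [b]; the inductive family says so
    without a transport. *)
Inductive Id (A : Type) (x : A -> C) : forall a b, hom (x a) (x b) -> Prop :=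
| Id_refl a : @Id A x a a 1.

Lemma Can_refl (A : Type) (x : A -> C) (R : forall a b, hom (x a) (x b) -> Prop) s :
  (forall a, R a a 1) -> @Can A A x x R s s 1.
Proof.
move=> HR; elim: s => [|a s IH]; first exact: Can_nil.
by rewrite /= -tensm_id; apply: Can_cons0.
Qed.

Lemma Ext_inv (A : Type) (x : A -> C) a r s e :
  @Ext A x a r s e ->
  exists e', [/\ @Can A A x x (@Id A x) (a :: r) s e', e' ∘ e = 1 & e ∘ e' = 1].
Proof.
elim=> {a r s e} [a s|a c r s e E [e' [F H1 H2]]].
  by exists 1; split; rewrite ?comp_id_l //; apply: Can_refl.
exists ((1 ⊠ e') ∘ sg _ _ _); split.
- apply: Can_cons F; last exact: Id_refl.
  by have := Ext_tail a (Ext_head x c r); rewrite tensm_id comp_id_r.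
- by rewrite compA (reassoc (sgK _ _ _)) comp_id_l -tens_1_comp H1 tensm_id.
- by rewrite compA (reassoc (esym (tens_1_comp _ _ _))) H2 tensm_id comp_id_l sgK.
Qed.

(** Undo the matched map and the rest, then reinsert the factor by the canonical inverse that
    [Ext_inv] provides. *)
Lemma Can_inv (A B : Type) (x : A -> C) (y : B -> C)
    (R : forall a b, hom (x a) (y b) -> Prop) (R' : forall b a, hom (y b) (x a) -> Prop) s t f :
  (forall a b φ, R a b φ -> exists2 ψ, R' b a ψ & ψ ∘ φ = 1 /\ φ ∘ ψ = 1) ->
  @Can A B x y R s t f -> exists f', [/\ @Can B A y x R' t s f', f' ∘ f = 1 & f ∘ f' = 1].
Proof.
move=> HR; elim=> {s t f} [|a b r s t e φ g E Rφ _ [g' [G' H1 H2]]].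
  by exists 1; rewrite comp_id_l; split=> //; apply: Can_nil.
have [ψ Rψ [K1 K2]] := HR _ _ _ Rφ.
have [e' [E' L1 L2]] := Ext_inv E.
exists (e' ∘ (ψ ⊠ g')); split.
- apply: (Can_comp _ (Can_cons0 Rψ G') E') => b0 a0 a1 φ0 ψ0 R0 I0.
  by case: I0 φ0 R0 => a2 φ0; rewrite comp_id_l.
- by rewrite compA (reassoc (esym (tensm_comp _ _ _ _ _))) K1 H1 tensm_id comp_id_l.
- by rewrite compA (reassoc L2) comp_id_l -tensm_comp K2 H2 tensm_id.
Qed.

(** * Existence and uniqueness for distinct labels *)

Lemma Ext_perm (A : eqType) (x : A -> C) a r s e :
  @Ext A x a r s e -> perm_eq s (a :: r).
Proof.
elim=> {a r s e} [a s|a c r s e _ IH]; first exact: perm_refl.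
by rewrite -(perm_cons c) in IH; apply: perm_trans IH _; have /= -> := perm_catCA [:: c] [:: a] r.
Qed.

Lemma Ext_exists (A : eqType) (x : A -> C) a s :
  a \in s -> exists r e, @Ext A x a r s e.
Proof.
elim: s => [//|c s IH]; rewrite inE; have [<- _|_ /= /IH [r [e E]]] := eqVneq.
  by exists s, 1; apply: Ext_head.
by exists (c :: r), (sg _ _ _ ∘ (1 ⊠ e)); apply: Ext_tail.
Qed.

(** The entries are distinct, so only one occurrence of [a] can be extracted. The type of [e]
    depends on [a] and [r], hence the equality of dependent pairs; keeping [a = a'] as a hypothesis
    leaves the index free for the inversion principle. *)
Lemma Ext_unique (A : eqType) (x : A -> C) a r s e a' r' e' :
  uniq s -> @Ext A x a r s e -> @Ext A x a' r' s e' -> a = a' ->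
  existT (fun p : A * seq A => hom (ten x s) (x p.1 ⊗ ten x p.2)) (a, r) e
    = existT _ (a', r') e'.
Proof.
move=> U E; elim: E U a' r' e' => {a r s e} [a s|a c r s e E IH] /= /andP[ncs us].
  apply: Ext_cons_inv => // a' r' e' /Ext_perm /perm_mem H aa'; move: (H a'); subst a'.
  by rewrite inE eqxx (negPf ncs).
apply: Ext_cons_inv => [ac|a' r' e' E' aa'].
  by subst c; move/Ext_perm/perm_mem: E => H; move: (H a); rewrite inE eqxx (negPf ncs).
have := IH us _ _ _ E' aa'.
exact: (congr1 (fun w : {p : A * seq A & hom (ten x s) (x p.1 ⊗ ten x p.2)} =>
  existT (fun p : A * seq A => hom (ten x (c :: s)) (x p.1 ⊗ ten x p.2))
    ((projT1 w).1, c :: (projT1 w).2) (sg _ _ _ ∘ (1 ⊠ projT2 w)))).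
Qed.

(** The head of [t] determines its partner in [s], hence the extraction, by [Ext_unique], and the
    applied map; the rest agrees by induction. *)
Lemma Can_unique (A : eqType) (B : Type) (x : A -> C) (y : B -> C)
    (R : forall a b, hom (x a) (y b) -> Prop) s t f f' :
  (forall a a' b φ φ', R a b φ -> R a' b φ' -> a = a') ->
  (forall a b φ φ', R a b φ -> R a b φ' -> φ = φ') ->
  uniq s -> @Can A B x y R s t f -> @Can A B x y R s t f' -> f = f'.
Proof.
move=> H1 H2 U F; elim: F U f' => {s t f} [_ f'|a b r s t e φ g E Rφ _ IH U].
  pose P s (f : hom (ten x s) (ten y [::])) :=
    match s return hom (ten x s) (ten y [::]) -> Prop with
    | [::] => fun f => idm (munit M) = f | _ => fun=> True end f.
  by apply: (@Can_nil_inv A B x y R [::] P).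
apply: Can_cons_inv => a' r' e' φ' g' E' Rφ' G'.
have aa' := H1 _ _ _ _ _ Rφ Rφ'; subst a'.
have Q := Ext_unique U E E' erefl.
have rr' : r = r' by have := congr1 (fun w => (projT1 w).2) Q.
subst r'; rewrite -(inj_pair2 _ _ _ _ _ Q) (H2 _ _ _ _ Rφ Rφ').
rewrite (IH _ _ G') //.
by move: U; rewrite (perm_uniq (Ext_perm E)) => /andP[].
Qed.

(** Induction on [t]: extract the partner of its head. Injectivity of [R] in both directions keeps
    the remaining labels in bijection. *)
Lemma Can_exists (A B : eqType) (x : A -> C) (y : B -> C)
    (R : forall a b, hom (x a) (y b) -> Prop) s t :
  (forall a b b' φ φ', R a b φ -> R a b' φ' -> b = b') ->
  (forall a a' b φ φ', R a b φ -> R a' b φ' -> a = a') ->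
  uniq s -> uniq t ->
  (forall a, a \in s -> exists b φ, b \in t /\ R a b φ) ->
  (forall b, b \in t -> exists a φ, a \in s /\ R a b φ) ->
  exists f, @Can A B x y R s t f.
Proof.
move=> H1 H2; elim: t s => [|b t IH] s us /= => [_ Hs _|/andP[nbt ut] Hs Ht].
  case: s us Hs => [|a s] _ Hs; first by exists 1; apply: Can_nil.
  by have [|b [φ []]] := Hs a; rewrite ?mem_head.
have [a [φ [sa Rφ]]] := Ht b (mem_head _ _).
have [r [e E]] := Ext_exists x sa.
have Hp := Ext_perm E; have Hm := perm_mem Hp.
move: us; rewrite (perm_uniq Hp) => /andP[nar ur].
have [a' ra'|b' tb'|g G] := IH r ur ut.
- have [|b' [φ' []]] := Hs a'; first by rewrite Hm inE ra' orbT.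
  move=> tb' R'; move: tb'; rewrite inE => /orP[/eqP bb'|tb']; last by exists b', φ'.
  by subst b'; case/negP: nar; rewrite (H2 _ _ _ _ _ Rφ R').
- have [|a' [φ' []]] := Ht b'; first by rewrite inE tb' orbT.
  move=> sa' R'; move: sa'; rewrite Hm inE => /orP[/eqP aa'|ra']; last by exists a', φ'.
  by subst a'; case/negP: nbt; rewrite (H1 _ _ _ _ _ Rφ R').
- by exists ((φ ⊠ g) ∘ e); apply: Can_cons E Rφ G.
Qed.

Lemma Can_Id_l (A B : Type) (x : A -> C) (y : B -> C)
    (R : forall a b, hom (x a) (y b) -> Prop) s t u f g :
  @Can A A x x (@Id A x) s t f -> @Can A B x y R t u g -> @Can A B x y R s u (g ∘ f).
Proof.
apply: Can_comp => a a' b φ ψ I0.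
by case: a a' φ / I0 ψ => a ψ; rewrite comp_id_r.
Qed.

Lemma Can_Id_r (A B : Type) (x : A -> C) (y : B -> C)
    (R : forall a b, hom (x a) (y b) -> Prop) s t u f g :
  @Can A B x y R s t f -> @Can B B y y (@Id B y) t u g -> @Can A B x y R s u (g ∘ f).
Proof.
apply: Can_comp => a b b' φ ψ R' I0.
by case: b b' ψ / I0 φ R' => b φ; rewrite comp_id_l.
Qed.

Lemma Id_inv (A : Type) (x : A -> C) a b φ :
  @Id A x a b φ -> exists2 ψ, @Id A x b a ψ & ψ ∘ φ = 1 /\ φ ∘ ψ = 1.
Proof. by case=> a0; exists 1; rewrite ?comp_id_l. Qed.

(** * Concatenation *)

Fixpoint mcat (A : Type) (x : A -> C) s t : hom (ten x s ⊗ ten x t) (ten x (s ++ t)) :=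
  match s with
  | [::] => λ
  | a :: s' => (1 ⊠ mcat x s' t) ∘ α
  end.

Lemma is_iso_mcat (A : Type) (x : A -> C) s t : is_iso (mcat x s t).
Proof.
elim: s => [|a s IH] /=; first exact: lambda_iso.
exact: is_iso_comp (is_iso_tens (is_iso_id _) IH) (alpha_iso _ _ _ _).
Qed.

Lemma Ext_cat_l (A : Type) (x : A -> C) a r s e t :
  @Ext A x a r s e -> exists2 e', @Ext A x a (r ++ t) (s ++ t) e' &
    e' ∘ mcat x s t = (1 ⊠ mcat x r t) ∘ α ∘ (e ⊠ 1).
Proof.
elim=> {a r s e} [a s|a c r s e E [e' E' H]].
  by exists 1; [exact: Ext_head|rewrite tensm_id comp_id_l comp_id_r].
exists (sg _ _ _ ∘ (1 ⊠ e')); first exact: Ext_tail.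
rewrite /= !compA (reassoc (esym (tens_1_comp _ _ _))) H !tens_1_comp !compA -alpha_nat.
by rewrite (reassoc2 (sg_nat _ _ _)) (reassoc3 (sg_alpha2 _ _ _ _)) !compA tens_comp_1.
Qed.

(** The extracted factor crosses all of [s], and each entry costs one use of [sg_alpha]. *)
Lemma Ext_cat_r (A : Type) (x : A -> C) a r t e s :
  @Ext A x a r t e -> exists2 e', @Ext A x a (s ++ r) (s ++ t) e' &
    e' ∘ mcat x s t = (1 ⊠ mcat x s r) ∘ sg _ _ _ ∘ (1 ⊠ e).
Proof.
move=> E; elim: s => [|c s [e' E' H]] /=.
  by exists e => //; rewrite (reassoc (lambda_sg _ _)) lambda_nat.
exists (sg _ _ _ ∘ (1 ⊠ e')); first exact: Ext_tail.
rewrite compA (reassoc (esym (tens_1_comp _ _ _))) H !tens_1_comp !compA -alpha_nat.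
by rewrite (reassoc2 (sg_nat _ _ _)) (reassoc3 (sg_alpha _ _ _ _)) !compA tensm_id.
Qed.

Lemma Can_cat (A B : Type) (x : A -> C) (y : B -> C)
    (R : forall a b, hom (x a) (y b) -> Prop) s t s' t' f g :
  @Can A B x y R s s' f -> @Can A B x y R t t' g ->
  exists2 k, @Can A B x y R (s ++ t) (s' ++ t') k &
    mcat y s' t' ∘ (f ⊠ g) = k ∘ mcat x s t.
Proof.
move=> F G; elim: F => {s s' f} [|a b r s s' e φ f E Rφ F [k K H]] /=.
  by exists g => //; rewrite lambda_nat.
have [e' E' H'] := Ext_cat_l t E.
exists ((φ ⊠ k) ∘ e'); first exact: Can_cons E' Rφ K.
rewrite !compA H' (reassoc (esym (tensm_comp _ _ _ _ _))) -H comp_id_r.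
rewrite -[g in LHS]comp_id_r tensm_comp (reassoc2 (alpha_nat _ _ _ _)).
by rewrite (reassoc (esym (tensm_comp _ _ _ _ _))) comp_id_l.
Qed.

(** The two lists are equal but not convertible, so the canonical map [k] replaces a transport along
    the associativity of [++]. *)
Lemma Can_mcat_alpha (A : Type) (x : A -> C) s t u :
  exists2 k, @Can A A x x (@Id A x) ((s ++ t) ++ u) (s ++ (t ++ u)) k &
    (mcat x s (t ++ u) ∘ (1 ⊠ mcat x t u)) ∘ α = k ∘ mcat x (s ++ t) u ∘ (mcat x s t ⊠ 1).
Proof.
elim: s => [|a s [k K H]] /=.
  exists 1; first by apply: Can_refl; exact: Id_refl.
  by rewrite lambda_nat compA lambda_alpha comp_id_l.
exists (1 ⊠ k); first by apply: Can_cons0 K; apply: Id_refl.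
rewrite !compA in H *.
rewrite tens_comp_1 -tensm_id (reassoc2 (alpha_nat _ _ _ _)) (reassoc2 (alpha_nat _ _ _ _)).
rewrite pentagon !(reassoc (esym (tens_1_comp _ _ _))) -!compA.
by rewrite !compA H.
Qed.

(** The triangle and [lambda_alpha] reduce this to [λ] at the tensor square of the unit being
    [1 ⊠ λ], which is the naturality of [λ] at itself. *)
Lemma lambda_rho : lambda M (munit M) = ρ.
Proof.
apply: tens_inj_1.
rewrite -lambda_alpha -triangle; congr (_ ∘ _).
by apply: (iso_mono (lambda_iso M _)); rewrite lambda_nat.
Qed.

Lemma Can_mcat_rinv (A : Type) (x : A -> C) s :
  @Can A A x x (@Id A x) s (s ++ [::]) (mcat x s [::] ∘ rinv _).
Proof.
elim: s => [|a s IH] /=; first by rewrite lambda_rho rhoK; apply: Can_nil.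
have -> : ((1 ⊠ mcat x s [::]) ∘ α) ∘ rinv (x a ⊗ ten x s) = 1 ⊠ (mcat x s [::] ∘ rinv _).
  apply: (iso_epi (rho_iso M _)); rewrite !compA rinvK comp_id_r.
  by rewrite -rho_alpha (reassoc (esym (tens_1_comp _ _ _))) compA rinvK comp_id_r.
by apply: Can_cons0 IH; apply: Id_refl.
Qed.

(** Induction on [t]: its head is extracted past [s] by [Ext_cat_r], and [alpha_sg] splits the
    exchange of blocks accordingly. *)
Lemma Can_mcat_sg (A : Type) (x : A -> C) s t u :
  exists2 k, @Can A A x x (@Id A x) (s ++ (t ++ u)) (t ++ (s ++ u)) k &
    (mcat x t (s ++ u) ∘ (1 ⊠ mcat x s u)) ∘ sg _ _ _
      = k ∘ mcat x s (t ++ u) ∘ (1 ⊠ mcat x t u).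
Proof.
elim: t => [|b t [k K H]] /=.
  exists 1; first by apply: Can_refl; exact: Id_refl.
  by rewrite lambda_nat compA sg_lambda comp_id_l.
have [e' E' H'] := Ext_cat_r s (Ext_head x b (t ++ u)).
exists ((1 ⊠ k) ∘ e'); first by apply: Can_cons E' _ K; apply: Id_refl.
rewrite !compA in H *; rewrite (reassoc H') !compA tensm_id comp_id_l.
rewrite tens_1_comp -[in LHS]tensm_id (reassoc2 (alpha_nat _ _ _ _)) alpha_sg.
rewrite (reassoc (esym (tens_1_comp _ _ _))) (reassoc (esym (tens_1_comp _ _ _))) compA H.
by rewrite !tens_1_comp !compA [in RHS](reassoc2 (sg_nat _ _ _)) ?tensm_id.
Qed.

(** * Flattening *)

(* [p] and [q] identify [X] and [Y] with right-bracketed tensor products of factors; [f] is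
   canonical if it becomes so under these identifications. *)
Definition canon (A B : Type) (x : A -> C) (y : B -> C)
    (R : forall a b, hom (x a) (y b) -> Prop) (X Y : C) s t
    (p : hom X (ten x s)) (q : hom Y (ten y t)) (f : hom X Y) :=
  exists2 k, Can R k & q ∘ f = k ∘ p.

Section Canon.
Variables (A B : Type) (x : A -> C) (y : B -> C).
Implicit Types (R : forall a b, hom (x a) (y b) -> Prop) (X Y Z : C).

Lemma canon_id (R : forall a b, hom (x a) (x b) -> Prop) X s (p : hom X (ten x s)) :
  (forall a, R a a 1) -> canon R p p 1.
Proof.
by move=> HR; exists 1; [exact: Can_refl|rewrite comp_id_l comp_id_r].
Qed.

Lemma canon_comp R (D : Type) (z : D -> C) (R' : forall b d, hom (y b) (z d) -> Prop)
    (R'' : forall a d, hom (x a) (z d) -> Prop) X Y Z s t u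
    (p : hom X (ten x s)) (q : hom Y (ten y t)) (r : hom Z (ten z u)) g f :
  (forall a b d φ ψ, R a b φ -> R' b d ψ -> R'' a d (ψ ∘ φ)) ->
  canon R' q r g -> canon R p q f -> canon R'' p r (g ∘ f).
Proof.
move=> HR [k' K' H'] [k K H]; exists (k' ∘ k); first exact: Can_comp HR K K'.
by rewrite -compA H' compA H compA.
Qed.

Lemma canon_Id_l R X Y Z s t u
    (p : hom X (ten x s)) (q : hom Y (ten x t)) (r : hom Z (ten y u)) g f :
  canon R q r g -> canon (@Id A x) p q f -> canon R p r (g ∘ f).
Proof.
move=> [k' K' H'] [k K H]; exists (k' ∘ k); first exact: Can_Id_l K K'.
by rewrite -compA H' compA H compA.
Qed.

Lemma canon_weak R (R' : forall a b, hom (x a) (y b) -> Prop) X Y s t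
    (p : hom X (ten x s)) (q : hom Y (ten y t)) f :
  (forall a b φ, R a b φ -> R' a b φ) -> canon R p q f -> canon R' p q f.
Proof. by move=> HR [k K H]; exists k => //; apply: Can_weak HR K. Qed.

(** [g] applies only identities to factors, so its canonical form has a canonical inverse and can be
    cancelled. *)
Lemma canon_cancel R X Y Z s t u
    (p : hom X (ten x s)) (q : hom Y (ten y t)) (r : hom Z (ten y u)) g f :
  canon (@Id B y) q r g -> canon R p r (g ∘ f) -> canon R p q f.
Proof.
move=> [k K H] [h Hh H'].
have [k' [K' H1 _]] := Can_inv (@Id_inv B y) K.
exists (k' ∘ h); first exact: Can_Id_r Hh K'.
by rewrite compA -H' -[r ∘ _]compA H !compA (reassoc H1) comp_id_l.
Qed.

Lemma canon_is_iso R X Y s t (p : hom X (ten x s)) (q : hom Y (ten y t)) f :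
  (forall a b φ, R a b φ -> is_iso φ) -> is_iso p -> is_iso q -> canon R p q f -> is_iso f.
Proof.
move=> HR ip iq [k K H].
have [|k' [_ K1 K2]] := @Can_inv A B x y R (fun b a ψ => is_iso ψ) s t k _ K.
  move=> a b φ /HR [ψ [H1 H2]]; exists ψ => //; by exists φ.
have ik : is_iso k by exists k'.
have -> : f = inv iq ∘ k ∘ p by rewrite -H -compA inv_l comp_id_l.
exact: is_iso_comp (is_iso_inv _) (is_iso_comp ik ip).
Qed.

End Canon.

Lemma canon_unique (A : eqType) (B : Type) (x : A -> C) (y : B -> C)
    (R : forall a b, hom (x a) (y b) -> Prop) X Y s t
    (p : hom X (ten x s)) (q : hom Y (ten y t)) f f' :
  (forall a a' b φ φ', R a b φ -> R a' b φ' -> a = a') ->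
  (forall a b φ φ', R a b φ -> R a b φ' -> φ = φ') ->
  uniq s -> is_iso q -> canon R p q f -> canon R p q f' -> f = f'.
Proof.
move=> H1 H2 us iq [k K H] [k' K' H']; apply: (iso_mono iq).
by rewrite H H' (Can_unique H1 H2 us K K').
Qed.

Lemma canon_exists (A B : Type) (x : A -> C) (y : B -> C)
    (R : forall a b, hom (x a) (y b) -> Prop) X Y s t
    (p : hom X (ten x s)) (q : hom Y (ten y t)) :
  is_iso q -> (exists k, @Can A B x y R s t k) -> exists f, canon R p q f.
Proof.
move=> iq [k K]; exists (inv iq ∘ k ∘ p), k => //.
by rewrite -compA inv_r comp_id_l.
Qed.

Definition ptens (A : Type) (x : A -> C) X Y s t
    (p : hom X (ten x s)) (q : hom Y (ten x t)) : hom (X ⊗ Y) (ten x (s ++ t)) :=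
  mcat x s t ∘ (p ⊠ q).

Lemma canon_tens (A B : Type) (x : A -> C) (y : B -> C)
    (R : forall a b, hom (x a) (y b) -> Prop) X Y X' Y' s t s' t'
    (p : hom X (ten x s)) (q : hom Y (ten y t)) (p' : hom X' (ten x s')) (q' : hom Y' (ten y t'))
    f f' :
  canon R p q f -> canon R p' q' f' -> canon R (ptens p p') (ptens q q') (f ⊠ f').
Proof.
move=> [k K H] [k' K' H'].
have [h Hh E] := Can_cat K K'; exists h => //.
by rewrite /ptens compA -tensm_comp H H' tensm_comp -compA E compA.
Qed.

Lemma rinv_nat (a b : C) (f : hom a b) : (f ⊠ 1) ∘ rinv a = rinv b ∘ f.
Proof.
apply: (iso_mono (rho_iso M _)).
by rewrite (reassoc2 (rho_nat _ _)) rhoK (reassoc (rhoK _)) comp_id_l comp_id_r.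
Qed.

(** * Canonicity of the associativity, symmetry and unit constraints *)

Section Coherence_data.
Variables (A : Type) (x : A -> C) (X Y Z : C) (s t u : seq A).
Variables (p : hom X (ten x s)) (q : hom Y (ten x t)) (r : hom Z (ten x u)).

Lemma canon_alpha :
  canon (@Id A x) (ptens (ptens p q) r) (ptens p (ptens q r)) (alpha M X Y Z).
Proof.
have [k K H] := Can_mcat_alpha x s t u; exists k => //.
have -> : ptens p (ptens q r) = mcat _ _ _ ∘ (1 ⊠ mcat _ _ _) ∘ (p ⊠ q ⊠ r).
  by rewrite /ptens -tensm_comp comp_id_l.
have -> : ptens (ptens p q) r = mcat _ _ _ ∘ (mcat _ _ _ ⊠ 1) ∘ ((p ⊠ q) ⊠ r).
  by rewrite /ptens -tensm_comp comp_id_l.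
rewrite !compA in H *.
by rewrite -alpha_nat (reassoc3 H) !compA.
Qed.

Lemma canon_sg : canon (@Id A x) (ptens p (ptens q r)) (ptens q (ptens p r)) (sg X Y Z).
Proof.
have [k K H] := Can_mcat_sg x s t u; exists k => //.
have -> : ptens p (ptens q r) = mcat _ _ _ ∘ (1 ⊠ mcat _ _ _) ∘ (p ⊠ q ⊠ r).
  by rewrite /ptens -tensm_comp comp_id_l.
have -> : ptens q (ptens p r) = mcat _ _ _ ∘ (1 ⊠ mcat _ _ _) ∘ (q ⊠ p ⊠ r).
  by rewrite /ptens -tensm_comp comp_id_l.
rewrite !compA in H *.
by rewrite -sg_nat (reassoc3 H) !compA.
Qed.

Lemma canon_rinv : canon (@Id A x) p (ptens p (idm (ten x [::]))) (rinv X).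
Proof.
exists (mcat x s [::] ∘ rinv _); first exact: Can_mcat_rinv.
by rewrite /ptens compA rinv_nat compA.
Qed.

Lemma canon_lambda : canon (@Id A x) (ptens (idm (ten x [::])) p) p λ.
Proof.
exists 1; first by apply: Can_refl; exact: Id_refl.
by rewrite /ptens /= lambda_nat comp_id_l.
Qed.

End Coherence_data.

Lemma canon_self (A : Type) (x : A -> C) X s (p : hom X (ten x s)) :
  canon (@Id A x) p p 1.
Proof. by apply: canon_id; apply: Id_refl. Qed.

(** * Substitution of tensor products for factors *)

Section Bind.
Variables (B A : Type) (Y : B -> C) (w : A -> C) (N : B -> seq A).
Variable p : forall b, hom (Y b) (ten w (N b)).

Fixpoint bind s : hom (ten Y s) (ten w (flatten (map N s))) :=
  match s with
  | [::] => 1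
  | b :: s' => ptens (p b) (bind s')
  end.

Lemma is_iso_bind s : (forall b, is_iso (p b)) -> is_iso (bind s).
Proof.
move=> ip; elim: s => [|b s IH] /=; first exact: is_iso_id.
exact: is_iso_comp (is_iso_mcat _ _ _) (is_iso_tens (ip b) IH).
Qed.

(** [canon_sg] moves whole blocks, so extracting a substituted factor is canonical on the flattened
    list. *)
Lemma canon_bind_Ext b r s e :
  @Ext B Y b r s e -> canon (@Id A w) (bind s) (ptens (p b) (bind r)) e.
Proof.
elim=> {b r s e} [b s|b c r s e E IH]; first exact: canon_self.
apply: canon_Id_l; first exact: canon_sg.
by apply: canon_tens; first exact: canon_self.
Qed.

Lemma canon_bind_mcat s t :
  canon (@Id A w) (ptens (bind s) (bind t)) (bind (s ++ t)) (mcat Y s t).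
Proof.
elim: s => [|b s IH] /=; first exact: canon_lambda.
apply: canon_Id_l; last exact: canon_alpha.
by apply: canon_tens; first exact: canon_self.
Qed.

End Bind.

Lemma canon_bind (B B' A A' : Type) (Y : B -> C) (Y' : B' -> C) (w : A -> C) (w' : A' -> C)
    (N : B -> seq A) (N' : B' -> seq A') (p : forall b, hom (Y b) (ten w (N b)))
    (p' : forall b, hom (Y' b) (ten w' (N' b))) (S : forall b b', hom (Y b) (Y' b') -> Prop)
    (R : forall a a', hom (w a) (w' a') -> Prop) s t f :
  (forall b b' φ, S b b' φ -> canon R (p b) (p' b') φ) -> @Can B B' Y Y' S s t f ->
  canon R (bind p s) (bind p' t) f.
Proof.
move=> HS; elim=> {s t f} [|b b' r s t e φ g E Sφ _ IH].
  by exists 1; [exact: Can_nil|].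
apply: canon_Id_l; last exact: canon_bind_Ext E.
by apply: canon_tens; first exact: HS.
Qed.

(** Associativity of flattening, reduced to single factors; [canon_bind_mcat] handles the
    concatenated list. *)
Lemma canon_bind_bind (B A D : Type) (Y : B -> C) (X : A -> C) (w : D -> C)
    (L : B -> seq A) (N : A -> seq D) (N' : B -> seq D) (Q : forall b, hom (Y b) (ten X (L b)))
    (P : forall a, hom (X a) (ten w (N a))) (Q' : forall b, hom (Y b) (ten w (N' b))) s :
  (forall b, canon (@Id D w) (Q' b) (bind P (L b)) (Q b)) ->
  canon (@Id D w) (bind Q' s) (bind P (flatten (map L s))) (bind Q s).
Proof.
move=> H; elim: s => [|b s IH] /=; first exact: canon_self.
apply: canon_Id_l; first exact: canon_bind_mcat.
exact: canon_tens.
Qed.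

(** [tensL] has no trailing unit on a nonempty list, whereas [ten] always ends in one; the inverse
    of [ρ] inserts it at the last factor. *)
Fixpoint unbr (A : Type) (x : A -> C) s : hom (tensL M x s) (ten x s) :=
  match s with
  | [::] => 1
  | a :: s' =>
      match s' return hom (tensL M x s') (ten x s') -> hom (tensL M x (a :: s')) (ten x (a :: s'))
      with
      | [::] => fun=> rinv _
      | _ :: _ => fun g => 1 ⊠ g
      end (unbr x s')
  end.

Lemma is_iso_unbr (A : Type) (x : A -> C) s : is_iso (unbr x s).
Proof.
elim: s => [|a [|b s] IH]; [exact: is_iso_id|exact: is_iso_inv|].
exact: is_iso_tens (is_iso_id _) IH.
Qed.

Inductive Graph (A : Type) (x y : A -> C) (m : forall a, hom (x a) (y a)) :
  forall a b, hom (x a) (y b) -> Prop :=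
| Graph_intro a : @Graph A x y m a a (m a).

Lemma Can_tensLm (A : Type) (x y : A -> C) (m : forall a, hom (x a) (y a)) s :
  exists2 g, @Can A A x y (Graph m) s s g & unbr y s ∘ tensLm M m s = g ∘ unbr x s.
Proof.
elim: s => [|a [|b s] [g G H]]; first by exists 1; [exact: Can_nil|].
  exists (m a ⊠ 1); last by rewrite /= rinv_nat.
  by apply: Can_cons0; [exact: Graph_intro|exact: Can_nil].
exists (m a ⊠ g); first by apply: Can_cons0 G; exact: Graph_intro.
change ((1 ⊠ unbr y (b :: s)) ∘ (m a ⊠ tensLm M m (b :: s)) = (m a ⊠ g) ∘ (1 ⊠ unbr x (b :: s))).
by rewrite -!tensm_comp H comp_id_l comp_id_r.
Qed.

Section Pres.
Variables (B A : Type) (Y : B -> C) (w : A -> C) (N : B -> seq A).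
Variable p : forall b, hom (Y b) (ten w (N b)).

Definition pres s : hom (tensL M Y s) (ten w (flatten (map N s))) := bind p s ∘ unbr Y s.

Lemma is_iso_pres s : (forall b, is_iso (p b)) -> is_iso (pres s).
Proof. by move=> ip; apply: is_iso_comp (is_iso_bind _ ip) (is_iso_unbr _ _). Qed.

Lemma canon_pres_unbr s : canon (@Id A w) (pres s) (bind p s) (unbr Y s).
Proof.
exists 1; last by rewrite comp_id_l.
by apply: Can_refl; exact: Id_refl.
Qed.

Lemma canon_leaf b : canon (@Id A w) (p b) (bind p [:: b]) (rinv (Y b)).
Proof. exact: canon_rinv. Qed.

End Pres.

Lemma canon_pres_pres (B A D : Type) (Y : B -> C) (X : A -> C) (w : D -> C)
    (L : B -> seq A) (N : A -> seq D) (N' : B -> seq D) (Q : forall b, hom (Y b) (ten X (L b)))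
    (P : forall a, hom (X a) (ten w (N a))) (Q' : forall b, hom (Y b) (ten w (N' b))) s :
  (forall b, canon (@Id D w) (Q' b) (bind P (L b)) (Q b)) ->
  canon (@Id D w) (pres Q' s) (bind P (flatten (map L s))) (pres Q s).
Proof.
by move=> H; apply: canon_Id_l; [apply: canon_bind_bind H|apply: canon_pres_unbr].
Qed.

(** [tensLm] reorders nothing: [Can_tensLm] makes it canonical over [s] itself, and substitution
    refines the factors. *)
Lemma canon_tensLm (B A A' : Type) (Y Y' : B -> C) (w : A -> C) (w' : A' -> C)
    (N : B -> seq A) (N' : B -> seq A') (p : forall b, hom (Y b) (ten w (N b)))
    (p' : forall b, hom (Y' b) (ten w' (N' b))) (R : forall a a', hom (w a) (w' a') -> Prop)
    (m : forall b, hom (Y b) (Y' b)) s :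
  (forall b, canon R (p b) (p' b) (m b)) -> canon R (pres p s) (pres p' s) (tensLm M m s).
Proof.
move=> H; have [g G E] := Can_tensLm m s.
apply: canon_cancel; first exact: canon_pres_unbr.
rewrite E; apply: canon_Id_l; last exact: canon_pres_unbr.
by apply: canon_bind G => b b' φ; case.
Qed.

(* Hence a structure cell may be defined using one choice of labels and used with any other:
   take [p0] and [q0] for the former, and let [P] and [P'] relabel or subdivide the factors. *)
Lemma canon_subst (B B' A A' : Type) (Y : B -> C) (Y' : B' -> C) (w : A -> C) (w' : A' -> C)
    (N : B -> seq A) (N' : B' -> seq A') (P : forall b, hom (Y b) (ten w (N b)))
    (P' : forall b, hom (Y' b) (ten w' (N' b))) (S : forall b b', hom (Y b) (Y' b') -> Prop)
    (R : forall a a', hom (w a) (w' a') -> Prop) X X' s t s' t'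
    (p0 : hom X (ten Y s)) (q0 : hom X' (ten Y' t)) (p : hom X (ten w s'))
    (q : hom X' (ten w' t')) f :
  canon (@Id A w) p (bind P s) p0 -> canon (@Id A' w') q (bind P' t) q0 ->
  (forall b b' φ, S b b' φ -> canon R (P b) (P' b') φ) ->
  canon S p0 q0 f -> canon R p q f.
Proof.
move=> Hp Hq HS [k K H]; apply: canon_cancel Hq _.
by rewrite H; apply: canon_Id_l Hp; apply: canon_bind HS K.
Qed.

(** * Labelled factors *)

Lemma Graph_comp (J : Type) (x x' x'' : J -> C) (m : forall j, hom (x j) (x' j))
    (m' : forall j, hom (x' j) (x'' j)) (m'' : forall j, hom (x j) (x'' j)) i j k φ ψ :
  (forall j, m'' j = m' j ∘ m j) ->
  @Graph J x x' m i j φ -> @Graph J x' x'' m' j k ψ -> @Graph J x x'' m'' i k (ψ ∘ φ).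
Proof.
move=> H G G'; case: j k ψ / G' φ G => k φ G.
by case: i k φ / G => j; rewrite -H; apply: Graph_intro.
Qed.

Lemma Graph_fun (J : Type) (x x' : J -> C) (m : forall j, hom (x j) (x' j)) i j φ ψ :
  @Graph J x x' m i j φ -> @Graph J x x' m i j ψ -> φ = ψ.
Proof.
(* Every member of the graph is a component of [m] transported along an equality of labels, and such
   equality proofs coincide. *)
suff H i' j' χ : @Graph J x x' m i' j' χ ->
    exists e : i' = j', χ = eq_rect i' (fun j => hom (x i') (x' j)) (m i') j' e.
  by move=> /H [e ->] /H [e' ->]; rewrite (proof_irrelevance _ e e').
by case=> k; exists erefl.
Qed.

Lemma is_iso_Graph (J : Type) (x x' : J -> C) (m : forall j, hom (x j) (x' j)) i j φ :
  (forall j, is_iso (m j)) -> @Graph J x x' m i j φ -> is_iso φ.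
Proof. by move=> im; case. Qed.

(* [r] tells which labels are matched.  Since [x (l a)] and [x (l' b)] are unrelated
   objects unless [l a] and [l' b] are identified, [Graph] takes the place of a transport. *)
Definition Lab (J : Type) (x x' : J -> C) (m : forall j, hom (x j) (x' j)) (A B : Type)
    (l : A -> J) (l' : B -> J) (r : A -> B -> Prop) :
  forall a b, hom (x (l a)) (x' (l' b)) -> Prop :=
  fun a b φ => r a b /\ @Graph J x x' m (l a) (l' b) φ.
Arguments Lab [J x x'] m [A B] l l' r [a b] φ.

Definition id_fam (J : Type) (x : J -> C) : forall j, hom (x j) (x j) := fun j => idm (x j).

Lemma Lab_comp (J : Type) (x x' x'' : J -> C) (m : forall j, hom (x j) (x' j))
    (m' : forall j, hom (x' j) (x'' j)) (m'' : forall j, hom (x j) (x'' j)) (A B D : Type)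
    (l : A -> J) (l' : B -> J) (l'' : D -> J) r r' (r'' : A -> D -> Prop) :
  (forall j, m'' j = m' j ∘ m j) -> (forall a b d, r a b -> r' b d -> r'' a d) ->
  forall a b d (φ : hom (x (l a)) (x' (l' b))) (ψ : hom (x' (l' b)) (x'' (l'' d))),
  Lab m l l' r φ -> Lab m' l' l'' r' ψ ->
  Lab m'' l l'' r'' (ψ ∘ φ).
Proof.
move=> Hm Hr a b d φ ψ [rab G] [rbd G']; split; first exact: Hr rab rbd.
exact: Graph_comp G G'.
Qed.

Lemma Lab_unique (J : Type) (x x' : J -> C) (m : forall j, hom (x j) (x' j)) (A : eqType)
    (B : Type) (l : A -> J) (l' : B -> J) (r : A -> B -> Prop) X Y s t
    (p : hom X (ten (fun a => x (l a)) s)) (q : hom Y (ten (fun b => x' (l' b)) t)) f f' :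
  (forall a a' b, r a b -> r a' b -> a = a') -> uniq s -> is_iso q ->
  canon (Lab m l l' r) p q f -> canon (Lab m l l' r) p q f' -> f = f'.
Proof.
move=> Hr; apply: canon_unique => [a a' b φ φ' [H _] [H' _]|a b φ φ' [_ G] [_ G']].
  exact: Hr H H'.
exact: Graph_fun G G'.
Qed.

Lemma Lab_exists (J : Type) (x : J -> C) (A B : eqType) (l : A -> J) (l' : B -> J)
    (r : A -> B -> Prop) s t :
  (forall a b b', r a b -> r a b' -> b = b') -> (forall a a' b, r a b -> r a' b -> a = a') ->
  (forall a b, r a b -> l a = l' b) -> uniq s -> uniq t ->
  (forall a, a \in s -> exists2 b, b \in t & r a b) ->
  (forall b, b \in t -> exists2 a, a \in s & r a b) ->
  exists k, Can (Lab (id_fam x) l l' r) (s := s) (t := t) k.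
Proof.
move=> Hr Hr' Hl us ut Hs Ht.
have R a b : r a b -> exists φ : hom (x (l a)) (x (l' b)), Lab (id_fam x) l l' r φ.
  move=> rab.
  suff [φ G] : exists φ, @Graph J x x (id_fam x) (l a) (l' b) φ by exists φ.
  by rewrite -(Hl _ _ rab); exists 1; apply: Graph_intro.
apply: Can_exists => // [a b b' φ φ' [H _] [H' _]|a a' b φ φ' [H _] [H' _]|a|b].
- exact: Hr H H'.
- exact: Hr' H H'.
- by move=> /Hs [b tb /R [φ Rφ]]; exists b, φ.
- by move=> /Ht [a sa /R [φ Rφ]]; exists a, φ.
Qed.

Lemma canon_leaf_rel (A B : Type) (x : A -> C) (y : B -> C)
    (R : forall a b, hom (x a) (y b) -> Prop) a b φ :
  R a b φ -> @canon A B x y R _ _ [:: a] [:: b] (rinv (x a)) (rinv (y b)) φ.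
Proof.
move=> Rφ; exists (φ ⊠ 1); last by rewrite rinv_nat.
by apply: Can_cons0 => //; apply: Can_nil.
Qed.

(** [tag] recovers the block of an entry, so distinct blocks are disjoint. *)
Lemma uniq_flatten_map (A B : eqType) (N : B -> seq A) (tag : A -> B) s :
  uniq s -> (forall b, uniq (N b)) -> (forall a b, a \in N b -> tag a = b) ->
  uniq (flatten (map N s)).
Proof.
move=> us uN Hd; elim: s us => //= b s IH /andP[nbs us].
rewrite cat_uniq uN IH // andbT; apply/hasPn => a /flattenP[_ /mapP[b' sb' ->] ab'].
by apply/negP => ab; case/negP: nbs; rewrite -(Hd _ _ ab) (Hd _ _ ab').
Qed.

Lemma mem_flatten_map (A B : eqType) (N : B -> seq A) s a :
  reflect (exists2 b, b \in s & a \in N b) (a \in flatten (map N s)).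
Proof.
apply: (iffP flattenP) => [[_ /mapP[b sb ->] ab]|[b sb ab]]; first by exists b.
by exists (N b) => //; apply: map_f.
Qed.

Lemma fibre_uniq (A : finType) (K : eqType) (g : A -> K) k : uniq (fibre g k).
Proof. by rewrite filter_uniq ?enum_uniq. Qed.

Lemma mem_fibre (A : finType) (K : eqType) (g : A -> K) k a : (a \in fibre g k) = (g a == k).
Proof. by rewrite mem_filter mem_enum andbT. Qed.

(** * Equality and invertibility of natural transformations *)

Lemma NatTrans_eq (D E : Category) (F G : Functor D E) (t u : NatTrans F G) :
  (forall a, t a = u a) -> t = u.
Proof.
case: t u => t tn [u un] /= H.
have E' : t = u by apply: functional_extensionality_dep.
by subst u; rewrite (proof_irrelevance _ tn un).
Qed.

Lemma inv2_NatTrans (D E : Category) (F G : Functor D E) (t : NatTrans F G) :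
  (forall a, exists u, Defs.comp u (t a) = idm (F a) /\ Defs.comp (t a) u = idm (G a)) ->
  @inv2 Cat D E F G t.
Proof.
move=> /(fun H a => constructive_indefinite_description _ (H a)) H.
have nat a b (f : hom a b) :
    Defs.comp (fmap F f) (proj1_sig (H a)) = Defs.comp (proj1_sig (H b)) (fmap G f).
  case: (H a) (H b) => [u [ua au]] [v [vb bv]] /=.
  rewrite -[LHS]comp_id_l -vb -[RHS]comp_id_r -au -!comp_assoc; congr (Defs.comp v _).
  by rewrite !comp_assoc ntnat.
exists (@Build_NatTrans _ _ G F (fun a => proj1_sig (H a)) nat).
by split; apply: NatTrans_eq => a /=; case: (H a) => u [].
Qed.

Lemma canon_Graph_id (K : Type) (Z : K -> C) (A A' : Type) (w : A -> C) (w' : A' -> C)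
    (L : K -> seq A) (L' : K -> seq A') (R : forall a a', hom (w a) (w' a') -> Prop)
    (p : forall k, hom (Z k) (ten w (L k))) (p' : forall k, hom (Z k) (ten w' (L' k))) k k' φ :
  (forall k, canon R (p k) (p' k) 1) -> @Graph K Z Z (id_fam Z) k k' φ ->
  canon R (p k) (p' k') φ.
Proof. by move=> H; case. Qed.

(** * Structure cells of the pseudofunctor *)

(** Convertible to the component at [k] of [spanFunctor M S] applied to [x]. *)
Definition fam (J K : finType) (S : Span J K) (x : J -> C) (k : K) : C :=
  tensL M (fun a => x (sl S a)) (fibre (sr S) k).

Definition leaf (A : Type) (w : A -> C) a : hom (w a) (ten w [:: a]) := rinv (w a).

Lemma is_iso_leaf (A : Type) (w : A -> C) a : is_iso (leaf w a).
Proof. exact: is_iso_inv. Qed.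

Section PresFam.
Variables (J K : finType) (S : Span J K) (x : J -> C) (A : Type) (w : A -> C).
Variables (N : apex S -> seq A) (p : forall a, hom (x (sl S a)) (ten w (N a))).

Definition presF (k : K) : hom (fam S x k) (ten w (flatten (map N (fibre (sr S) k)))) :=
  pres p (fibre (sr S) k).

Lemma is_iso_presF k : (forall a, is_iso (p a)) -> is_iso (presF k).
Proof. exact: is_iso_pres. Qed.

End PresFam.

Section Refine.
Variables (A A' : Type) (w : A -> C) (w' : A' -> C).
Variable R : forall a a', hom (w a) (w' a') -> Prop.
Variables (J K : finType) (S : Span J K).

Lemma canon_fmap (x x' : J -> C) (N : apex S -> seq A) (N' : apex S -> seq A')
    (p : forall a, hom (x (sl S a)) (ten w (N a)))
    (p' : forall a, hom (x' (sl S a)) (ten w' (N' a))) (m : forall j, hom (x j) (x' j)) k :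
  (forall a, canon R (p a) (p' a) (m (sl S a))) ->
  canon R (presF p k) (presF p' k)
    (@fmap _ _ (spanFunctor M S) (x : ProdCat C J) (x' : ProdCat C J) m k).
Proof. by move=> H; apply: canon_tensLm. Qed.

Lemma canon_presF_id (x : J -> C) (N : apex S -> seq A) (N' : apex S -> seq A')
    (p : forall a, hom (x (sl S a)) (ten w (N a)))
    (p' : forall a, hom (x (sl S a)) (ten w' (N' a))) k :
  (forall a, canon R (p a) (p' a) 1) -> canon R (presF p k) (presF p' k) 1.
Proof.
(* The identity is written as a tensor product of identities, to which [canon_tensLm] applies. *)
move=> H; rewrite /fam -(tensLm_id M (fun a => x (sl S a))).
exact: canon_tensLm.
Qed.

End Refine.

(** * Cells for invertible morphisms of spans *)

Section TwoCell.
Variables (J K : finType) (S S' : Span J K) (t : SpanMor S S').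
Hypothesis t_inv : @inv2 SpanFin J K S S' t.

(** [t] is bijective and commutes with the legs, so it restricts to bijections between the
    fibres. *)
Lemma F2_exists (x : J -> C) k : exists f : hom (fam S x k) (fam S' x k),
  canon (Lab (id_fam x) (sl S) (sl S') (fun a b => smap t a = b))
    (unbr (fun a => x (sl S a)) (fibre (sr S) k)) (unbr (fun b => x (sl S' b)) (fibre (sr S') k)) f.
Proof.
have [g [tg gt]] := sp_inv2_bij t_inv.
apply: canon_exists; first exact: is_iso_unbr.
apply: Lab_exists => [a b b' <- <- //|a a' b <- /(can_inj tg) ->//|a b <-|||a|b].
- by rewrite (smapP t a).1.
- exact: fibre_uniq.
- exact: fibre_uniq.
- by rewrite mem_fibre => H; exists (smap t a) => //; rewrite mem_fibre (smapP t a).2.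
- rewrite mem_fibre => H; exists (g b); last exact: gt.
  by rewrite mem_fibre -(smapP t _).2 gt.
Qed.

(** Chosen from an existence statement; uniqueness of canonical maps makes the choice determined by
    its specification. *)
Definition F2map x k := proj1_sig (constructive_indefinite_description _ (F2_exists x k)).

(** Frees the cell from the labels that define it: the factors on both sides may be presented in any
    compatible way. *)
Lemma canon_F2 (x : J -> C) (A A' : Type) (w : A -> C) (w' : A' -> C)
    (R : forall a a', hom (w a) (w' a') -> Prop) (N : apex S -> seq A) (N' : apex S' -> seq A')
    (p : forall a, hom (x (sl S a)) (ten w (N a)))
    (p' : forall a, hom (x (sl S' a)) (ten w' (N' a))) k :
  (forall a b φ, smap t a = b -> @Graph J x x (id_fam x) (sl S a) (sl S' b) φ ->
     canon R (p a) (p' b) φ) ->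
  canon R (presF p k) (presF p' k) (F2map x k).
Proof.
move=> H.
apply: canon_subst (canon_pres_unbr _ _) (canon_pres_unbr _ _) _ (proj2_sig _).
by move=> a b φ [E G]; apply: H.
Qed.

End TwoCell.

(** * Cells for composition *)

Section Composition.
Variables (J K L : finType) (T : Span K L) (S : Span J K).

(** Labels are pairs [(t, s)]; the nested fibres list only pairs on which the inner legs agree. *)
Definition base2 (x : J -> C) (l : L) :
  hom (fam T (fam S x) l)
      (ten (fun q : apex T * apex S => x (sl S q.2))
         (flatten (map (fun t => flatten (map (fun s => [:: (t, s)]) (fibre (sr S) (sl T t))))
           (fibre (sr T) l)))) :=
  @presF K L T (fam S x) _ _ _ (fun t => @presF J K S x _ _ (fun s => [:: (t, s)])
    (fun s => leaf (fun q : apex T * apex S => x (sl S q.2)) (t, s)) (sl T t)) l.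

Lemma uniq_base2 l :
  uniq (flatten (map (fun t => flatten (map (fun s => [:: (t, s)]) (fibre (sr S) (sl T t))))
    (fibre (sr T) l))).
Proof.
apply: (@uniq_flatten_map _ _ _ fst); first exact: fibre_uniq.
  move=> t; apply: (@uniq_flatten_map _ _ _ snd) => //; first exact: fibre_uniq.
  by move=> q s; rewrite inE => /eqP ->.
by move=> q t /mem_flatten_map [s _]; rewrite inE => /eqP ->.
Qed.

(** A listed pair [(t, s)] is a point of the pullback, stored there as [(s, t)]; hence the swapped
    components in the matching. *)
Lemma Fc_exists (x : J -> C) l :
  exists f : hom (fam T (fam S x) l) (fam (spcomp T S) x l),
  canon (Lab (id_fam x) (fun q : apex T * apex S => sl S q.2) (sl (spcomp T S))
           (fun q b => val b = (q.2, q.1)))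
    (base2 x l) (unbr (fun b => x (sl (spcomp T S) b)) (fibre (sr (spcomp T S)) l)) f.
Proof.
apply: canon_exists; first exact: is_iso_unbr.
apply: Lab_exists => [a b b' H H'|[t s] [t' s'] b /= -> [-> ->] //|[t s] [b hb] /= -> //|||[t s]|b].
- by apply: val_inj; rewrite H H'.
- exact: uniq_base2.
- exact: fibre_uniq.
- move=> /mem_flatten_map [t' Ht] /mem_flatten_map [s' Hs]; rewrite inE => /eqP [-> ->].
  move: Ht Hs; rewrite !mem_fibre => Ht Hs.
  by exists (exist _ (s', t') Hs); rewrite ?mem_fibre.
- rewrite mem_fibre => H; exists ((val b).2, (val b).1); last by case: (val b).
  apply/mem_flatten_map; exists (val b).2; first by rewrite mem_fibre.
  apply/mem_flatten_map; exists (val b).1; last by rewrite inE.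
  by rewrite mem_fibre (valP b).
Qed.

Definition Fcmap x l := proj1_sig (constructive_indefinite_description _ (Fc_exists x l)).

Lemma canon_Fc (x : J -> C) (A A' : Type) (w : A -> C) (w' : A' -> C)
    (R : forall a a', hom (w a) (w' a') -> Prop) (N : apex T -> apex S -> seq A)
    (N' : apex (spcomp T S) -> seq A') (p : forall t s, hom (x (sl S s)) (ten w (N t s)))
    (p' : forall b, hom (x (sl (spcomp T S) b)) (ten w' (N' b))) l :
  (forall t s (b : apex (spcomp T S)) φ, val b = (s, t) ->
     @Graph J x x (id_fam x) (sl S s) (sl (spcomp T S) b) φ -> canon R (p t s) (p' b) φ) ->
  canon R (@presF K L T (fam S x) _ _ _ (fun t => presF (p t) (sl T t)) l) (presF p' l)
    (Fcmap x l).
Proof.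
move=> H.
apply: (canon_subst (P := fun q : apex T * apex S => p q.1 q.2) _ (canon_pres_unbr _ _) _
  (proj2_sig (constructive_indefinite_description _ (Fc_exists x l)))).
  (* Refine the outer level of [base2], then the inner one, and finally the single factors. *)
  apply: canon_pres_pres => t; apply: canon_pres_pres => s.
  exact: (@canon_leaf (apex T * apex S) A (fun q => x (sl S q.2)) w (fun q => N q.1 q.2)
    (fun q => p q.1 q.2) (t, s)).
by move=> [t s] b φ [E G]; apply: H.
Qed.

End Composition.

(** * Cells for identity spans *)

Section Unit.
Variable J : finType.

(** The fibre of the identity over [j] contains [j] alone, which is matched with the one factor of
    the source, labelled [tt]. *)
Lemma Fu_exists (x : J -> C) j : exists f : hom (x j) (fam (spid J) x j),
  canon (Lab (id_fam x) (fun _ : unit => j) (sl (spid J)) (fun _ b => b = j))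
    (leaf (fun _ : unit => x j) tt) (unbr x (fibre (sr (spid J)) j)) f.
Proof.
apply: canon_exists; first exact: is_iso_unbr.
apply: Lab_exists => [a b b' -> -> //|[] [] //|a b -> //|//|||b].
- exact: fibre_uniq.
- by move=> a _; exists j => //; rewrite mem_fibre.
- by rewrite mem_fibre => /eqP Hb; exists tt; rewrite ?mem_head.
Qed.

Definition Fumap x j := proj1_sig (constructive_indefinite_description _ (Fu_exists x j)).

Lemma canon_Fu (x : J -> C) (A A' : Type) (w : A -> C) (w' : A' -> C)
    (R : forall a a', hom (w a) (w' a') -> Prop) j (N : seq A) (N' : J -> seq A')
    (p : hom (x j) (ten w N)) (p' : forall i, hom (x i) (ten w' (N' i))) :
  canon R p (p' j) 1 -> canon R p (@presF J J (spid J) x _ _ _ p' j) (Fumap x j).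
Proof.
move=> H.
apply: (canon_subst (P := fun _ : unit => p) (canon_leaf _ tt) (canon_pres_unbr _ _) _
  (proj2_sig (constructive_indefinite_description _ (Fu_exists x j)))).
move=> [] b φ /= [E]; subst b => G.
(* Over equal labels, membership in the graph forces [φ] to be the identity. *)
by rewrite (Graph_fun G (Graph_intro (id_fam x) j)).
Qed.

End Unit.

(** * Comparison of structure cells by their matchings *)

Definition pres1 (J K : finType) (S : Span J K) (x : J -> C) (k : K) :
  hom (fam S x k) (ten (fun s => x (sl S s)) (flatten (map (fun s => [:: s]) (fibre (sr S) k)))) :=
  presF (leaf (fun s => x (sl S s))) k.

Lemma is_iso_pres1 (J K : finType) (S : Span J K) x k : is_iso (pres1 S x k).
Proof. by apply: is_iso_presF => s; apply: is_iso_leaf. Qed.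

Lemma uniq_pres1 (J K : finType) (S : Span J K) k :
  uniq (flatten (map (fun s => [:: s]) (fibre (sr S) k))).
Proof.
apply: (@uniq_flatten_map _ _ _ id) => //; first exact: fibre_uniq.
by move=> s s'; rewrite inE => /eqP.
Qed.

(** The working form of uniqueness: it is enough that both matchings lie in one relation under which
    a target label has at most one source, so they need not be stated alike. *)
Lemma Lab_eq (J : Type) (x x' : J -> C) (m : forall j, hom (x j) (x' j)) (A : eqType)
    (B : Type) (l : A -> J) (l' : B -> J) (r r1 r2 : A -> B -> Prop) X Y s t
    (p : hom X (ten (fun a => x (l a)) s)) (q : hom Y (ten (fun b => x' (l' b)) t)) f f' :
  canon (Lab m l l' r1) p q f -> canon (Lab m l l' r2) p q f' ->
  (forall a b, r1 a b -> r a b) -> (forall a b, r2 a b -> r a b) ->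
  (forall a a' b, r a b -> r a' b -> a = a') -> uniq s -> is_iso q -> f = f'.
Proof.
move=> H1 H2 Hr1 Hr2 Hr us iq; apply: (Lab_unique (m := m) Hr us iq).
  by apply: canon_weak H1 => a b φ [rab G]; split; [exact: Hr1|exact: G].
by apply: canon_weak H2 => a b φ [rab G]; split; [exact: Hr2|exact: G].
Qed.

Lemma canon_Lab_comp (J : Type) (x x' x'' : J -> C) (m : forall j, hom (x j) (x' j))
    (m' : forall j, hom (x' j) (x'' j)) (m'' : forall j, hom (x j) (x'' j)) (A B D : Type)
    (l : A -> J) (l' : B -> J) (l'' : D -> J) r r' X Y Z s t u
    (p : hom X (ten (fun a => x (l a)) s)) (q : hom Y (ten (fun b => x' (l' b)) t))
    (o : hom Z (ten (fun d => x'' (l'' d)) u)) g f :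
  (forall j, m'' j = m' j ∘ m j) -> canon (Lab m' l' l'' r') q o g ->
  canon (Lab m l l' r) p q f ->
  canon (Lab m'' l l'' (fun a d => exists2 b, r a b & r' b d)) p o (g ∘ f).
Proof.
by move=> Hm; apply: canon_comp; apply: Lab_comp => // a b d rab rbd; exists b.
Qed.

Lemma id_famK (J : Type) (x : J -> C) j : id_fam x j = id_fam x j ∘ id_fam x j.
Proof. by rewrite comp_id_l. Qed.

Lemma canon_leaf_id (J : Type) (x : J -> C) (A B : Type) (l : A -> J) (l' : B -> J)
    (r : A -> B -> Prop) a b φ :
  r a b -> @Graph J x x (id_fam x) (l a) (l' b) φ ->
  canon (Lab (id_fam x) l l' r) (leaf (fun a => x (l a)) a) (leaf (fun b => x (l' b)) b) φ.
Proof. by move=> rab G; apply: canon_leaf_rel. Qed.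

Lemma canon_F2_pres1 (J K : finType) (S S' : Span J K) (t : SpanMor S S')
    (t_inv : @inv2 SpanFin J K S S' t) (x : J -> C) k :
  canon (Lab (id_fam x) (sl S) (sl S') (fun a b => smap t a = b)) (pres1 S x k) (pres1 S' x k)
    (F2map t_inv x k).
Proof. by apply: canon_F2 => a b φ E G; apply: canon_leaf_rel. Qed.

Lemma F2map_id (J K : finType) (S : Span J K) (t_inv : @inv2 SpanFin J K S S (sp_id2 S))
    (x : J -> C) k :
  F2map t_inv x k = 1.
Proof.
have H : canon (Lab (id_fam x) (sl S) (sl S) eq) (pres1 S x k) (pres1 S x k) 1.
  by apply: canon_presF_id => a; apply: canon_leaf_id => //; apply: Graph_intro.
apply: (Lab_eq (r := eq) (canon_F2_pres1 t_inv x k) H) => //.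
- by move=> a b; rewrite smap_mk.
- by move=> a a' b -> ->.
- exact: uniq_pres1.
- exact: is_iso_pres1.
Qed.

Lemma F2map_comp (J K : finType) (S S' S'' : Span J K) (t : SpanMor S' S'')
    (s : SpanMor S S') (t_inv : @inv2 SpanFin J K S' S'' t)
    (s_inv : @inv2 SpanFin J K S S' s) (ts_inv : @inv2 SpanFin J K S S'' (sp_vcomp t s))
    (x : J -> C) k :
  F2map ts_inv x k = F2map t_inv x k ∘ F2map s_inv x k.
Proof.
apply: (Lab_eq (r := fun a b => smap (sp_vcomp t s) a = b) (canon_F2_pres1 ts_inv x k)
  (canon_Lab_comp (id_famK x) (canon_F2_pres1 t_inv x k) (canon_F2_pres1 s_inv x k))) => //.
- by move=> a b [c <- <-]; rewrite smap_mk.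
- by move=> a a' b <-; have [g [tg _]] := sp_inv2_bij ts_inv; move=> /(can_inj tg).
- exact: uniq_pres1.
- exact: is_iso_pres1.
Qed.

Section TwoCellNat.
Variables (J K : finType) (S S' : Span J K) (t : SpanMor S S').
Hypothesis t_inv : @inv2 SpanFin J K S S' t.

(** Both composites apply [m] along the matching of [t], since the cell itself applies
    identities. *)
Lemma F2map_nat (x x' : J -> C) (m : forall j, hom (x j) (x' j)) k :
  @fmap _ _ (spanFunctor M S') (x : ProdCat C J) (x' : ProdCat C J) m k ∘ F2map t_inv x k
  = F2map t_inv x' k ∘ @fmap _ _ (spanFunctor M S) (x : ProdCat C J) (x' : ProdCat C J) m k.
Proof.
have H T : canon (Lab m (sl T) (sl T) eq) (pres1 T x k) (pres1 T x' k)
    (@fmap _ _ (spanFunctor M T) (x : ProdCat C J) (x' : ProdCat C J) m k).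
  by apply: canon_fmap => a; apply: canon_leaf_rel; split=> //; apply: Graph_intro.
apply: (Lab_eq (r := fun a b => smap t a = b)
  (canon_Lab_comp (m'' := m) _ (H S') (canon_F2_pres1 t_inv x k))
  (canon_Lab_comp (m'' := m) _ (canon_F2_pres1 t_inv x' k) (H S))).
- by move=> j; rewrite comp_id_r.
- by move=> j; rewrite comp_id_l.
- by move=> a b [b' H' <-].
- by move=> a b [a' <-].
- by move=> a a' b <-; have [g [tg _]] := sp_inv2_bij t_inv; move=> /(can_inj tg).
- exact: uniq_pres1.
- exact: is_iso_pres1.
Qed.

Definition F2N : NatTrans (spanFunctor M S) (spanFunctor M S').
Proof.
refine (@Build_NatTrans _ _ (spanFunctor M S) (spanFunctor M S')
  (fun (x : ProdCat C J) k => F2map t_inv x k) _).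
by move=> x x' m; apply: functional_extensionality_dep => k; apply: F2map_nat.
Defined.

End TwoCellNat.

Section CompositionNat.
Variables (J K L : finType) (T : Span K L) (S : Span J K).

Lemma canon_Fc_pres1 (x : J -> C) l :
  canon (Lab (id_fam x) (fun q : apex T * apex S => sl S q.2) (sl (spcomp T S))
           (fun q b => val b = (q.2, q.1)))
    (base2 T S x l) (pres1 (spcomp T S) x l) (Fcmap T S x l).
Proof.
apply: (@canon_Fc _ _ _ T S x _ _ _ _ _ (fun t s => [:: (t, s)]) _
  (fun t s => leaf (fun q : apex T * apex S => x (sl S q.2)) (t, s))).
by move=> t s b φ E G; apply: canon_leaf_rel.
Qed.

Lemma Fcmap_nat (x x' : J -> C) (m : forall j, hom (x j) (x' j)) l :
  @fmap _ _ (spanFunctor M (spcomp T S)) (x : ProdCat C J) (x' : ProdCat C J) m l ∘ Fcmap T S x l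
  = Fcmap T S x' l ∘
    @fmap _ _ (compF (spanFunctor M T) (spanFunctor M S)) (x : ProdCat C J) (x' : ProdCat C J) m l.
Proof.
have H1 : canon (Lab m (sl (spcomp T S)) (sl (spcomp T S)) eq)
    (pres1 (spcomp T S) x l) (pres1 (spcomp T S) x' l)
    (@fmap _ _ (spanFunctor M (spcomp T S)) (x : ProdCat C J) (x' : ProdCat C J) m l).
  by apply: canon_fmap => a; apply: canon_leaf_rel; split=> //; apply: Graph_intro.
have H2 : canon (Lab m (fun q : apex T * apex S => sl S q.2) (fun q => sl S q.2) eq)
    (base2 T S x l) (base2 T S x' l)
    (@fmap _ _ (compF (spanFunctor M T) (spanFunctor M S)) (x : ProdCat C J) (x' : ProdCat C J) m l).
  apply: (@canon_fmap _ _ _ _ _ K L T (fam S x) (fam S x')) => t.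
  apply: canon_fmap => s; apply: canon_leaf_rel; split=> //; exact: Graph_intro.
apply: (Lab_eq (r := fun q b => val b = (q.2, q.1))
  (canon_Lab_comp (m'' := m) _ H1 (canon_Fc_pres1 x l))
  (canon_Lab_comp (m'' := m) _ (canon_Fc_pres1 x' l) H2)).
- by move=> j; rewrite comp_id_r.
- by move=> j; rewrite comp_id_l.
- by move=> q b [b' H <-].
- by move=> q b [q' <-].
- by move=> [t s] [t' s'] b /= -> [-> ->].
- exact: uniq_base2.
- exact: is_iso_pres1.
Qed.

End CompositionNat.

Lemma is_iso_base2 (J K L : finType) (T : Span K L) (S : Span J K) x l : is_iso (base2 T S x l).
Proof. by apply: is_iso_presF => t; apply: is_iso_presF => s; apply: is_iso_leaf. Qed.

Lemma canon_Lab_is_iso (J : Type) (x : J -> C) (A B : Type) (l : A -> J) (l' : B -> J) r X Y s t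
    (p : hom X (ten (fun a => x (l a)) s)) (q : hom Y (ten (fun b => x (l' b)) t)) f :
  is_iso p -> is_iso q -> canon (Lab (id_fam x) l l' r) p q f -> is_iso f.
Proof.
apply: canon_is_iso => a b φ [_]; apply: is_iso_Graph => j; exact: is_iso_id.
Qed.

Lemma inv2_pointwise (D : Category) (K : Type) (F G : Functor D (ProdCat C K)) (t : NatTrans F G) :
  (forall x k, is_iso ((t x : forall k, hom ((F x : K -> C) k) ((G x : K -> C) k)) k)) ->
  @inv2 Cat D (ProdCat C K) F G t.
Proof.
move=> H; apply: inv2_NatTrans => x; exists (fun k => inv (H x k)).
by split; apply: functional_extensionality_dep => k /=; [apply: inv_l|apply: inv_r].
Qed.

(** * Invertible comparison cells *)

Section CompositionCell.
Variables (J K L : finType) (T : Span K L) (S : Span J K).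

Definition FcN :
  NatTrans (compF (spanFunctor M T) (spanFunctor M S)) (spanFunctor M (spcomp T S)).
Proof.
refine (@Build_NatTrans _ _ (compF (spanFunctor M T) (spanFunctor M S))
  (spanFunctor M (spcomp T S)) (fun (x : ProdCat C J) l => Fcmap T S x l) _).
by move=> x x' m; apply: functional_extensionality_dep => l; apply: Fcmap_nat.
Defined.

Lemma FcN_inv : @inv2 Cat _ _ _ _ FcN.
Proof.
apply: inv2_pointwise => x l.
exact: canon_Lab_is_iso (is_iso_base2 _ _ _ _) (is_iso_pres1 _ _ _) (canon_Fc_pres1 T S x l).
Qed.

End CompositionCell.

Section UnitCell.
Variable J : finType.

Lemma canon_Fu_pres1 (x : J -> C) j :
  canon (Lab (id_fam x) (fun _ : unit => j) (sl (spid J)) (fun _ b => b = j))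
    (leaf (fun _ : unit => x j) tt) (pres1 (spid J) x j) (Fumap x j).
Proof. by apply: canon_Fu; apply: canon_leaf_rel; split=> //; apply: Graph_intro. Qed.

Lemma Fumap_nat (x x' : J -> C) (m : forall j, hom (x j) (x' j)) j :
  @fmap _ _ (spanFunctor M (spid J)) (x : ProdCat C J) (x' : ProdCat C J) m j ∘ Fumap x j
  = Fumap x' j ∘ m j.
Proof.
have H1 : canon (Lab m (sl (spid J)) (sl (spid J)) eq) (pres1 (spid J) x j) (pres1 (spid J) x' j)
    (@fmap _ _ (spanFunctor M (spid J)) (x : ProdCat C J) (x' : ProdCat C J) m j).
  by apply: canon_fmap => a; apply: canon_leaf_rel; split=> //; apply: Graph_intro.
have H2 : canon (Lab m (fun _ : unit => j) (fun _ : unit => j) eq)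
    (leaf (fun _ : unit => x j) tt) (leaf (fun _ : unit => x' j) tt) (m j).
  by apply: canon_leaf_rel; split=> //; apply: Graph_intro.
apply: (Lab_eq (r := fun _ b => b = j) (canon_Lab_comp (m'' := m) _ H1 (canon_Fu_pres1 x j))
  (canon_Lab_comp (m'' := m) _ (canon_Fu_pres1 x' j) H2)).
- by move=> i; rewrite comp_id_r.
- by move=> i; rewrite comp_id_l.
- by move=> q b [b' H <-].
- by move=> q b [].
- by move=> [] [].
- by [].
- exact: is_iso_pres1.
Qed.

Definition FuN : NatTrans (idF (ProdCat C J)) (spanFunctor M (spid J)).
Proof.
refine (@Build_NatTrans _ _ (idF (ProdCat C J)) (spanFunctor M (spid J))
  (fun (x : ProdCat C J) j => Fumap x j) _).
by move=> x x' m; apply: functional_extensionality_dep => j; apply: Fumap_nat.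
Defined.

Lemma FuN_inv : @inv2 Cat _ _ _ _ FuN.
Proof.
apply: inv2_pointwise => x l.
exact: canon_Lab_is_iso (is_iso_leaf _ _) (is_iso_pres1 _ _ _) (canon_Fu_pres1 x l).
Qed.

End UnitCell.

(** * Naturality, associativity and unit axioms *)

Lemma Fcmap_F2map (J K L : finType) (T T' : Span K L) (S S' : Span J K)
    (t : SpanMor T T') (s : SpanMor S S') (t_inv : @inv2 SpanFin _ _ _ _ t)
    (s_inv : @inv2 SpanFin _ _ _ _ s) (ts_inv : @inv2 SpanFin _ _ _ _ (sp_hcomp2 t s))
    (x : J -> C) l :
  Fcmap T' S' x l ∘ F2map t_inv (fam S' x) l ∘
    @fmap _ _ (spanFunctor M T) (fam S x : ProdCat C K) (fam S' x : ProdCat C K)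
      (fun k => F2map s_inv x k) l
  = F2map ts_inv x l ∘ Fcmap T S x l.
Proof.
have H1 : canon (Lab (id_fam x) (fun q : apex T * apex S => sl S q.2)
      (fun q : apex T * apex S' => sl S' q.2) (fun a b => a.1 = b.1 /\ smap s a.2 = b.2))
    (base2 T S x l) (base2 T S' x l)
    (@fmap _ _ (spanFunctor M T) (fam S x : ProdCat C K) (fam S' x : ProdCat C K)
      (fun k => F2map s_inv x k) l).
  by apply: canon_fmap => a; apply: canon_F2 => b c φ E G; apply: canon_leaf_rel.
have H2 : canon (Lab (id_fam x) (fun q : apex T * apex S' => sl S' q.2)
      (fun q : apex T' * apex S' => sl S' q.2) (fun a b => smap t a.1 = b.1 /\ a.2 = b.2))
    (base2 T S' x l) (base2 T' S' x l) (F2map t_inv (fam S' x) l).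
  apply: canon_F2 => a b φ E; apply: canon_Graph_id => k.
  by apply: canon_presF_id => c; apply: canon_leaf_rel; split=> //; apply: Graph_intro.
(* Either way round, the pair [a] is matched with the pullback point with components [smap s a.2]
   and [smap t a.1]. *)
apply: (Lab_eq (r := fun a b => smap s a.2 = (val b).1 /\ smap t a.1 = (val b).2)
  (canon_Lab_comp (id_famK x) (canon_Fc_pres1 T' S' x l) (canon_Lab_comp (id_famK x) H2 H1))
  (canon_Lab_comp (id_famK x) (canon_F2_pres1 ts_inv x l) (canon_Fc_pres1 T S x l))).
- by move=> a b [c [d [-> ->] [<- ->]] ->].
- by move=> a b [c Hc <-]; rewrite smap_mk /= Hc.
- move=> [a1 a2] [b1 b2] c /= [<- <-] [].
  have [g [sg' _]] := sp_inv2_bij s_inv; have [h [th _]] := sp_inv2_bij t_inv.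
  by move=> /(can_inj sg') -> /(can_inj th) ->.
- exact: uniq_base2.
- exact: is_iso_pres1.
Qed.

(** Both composites match a triple [(u, (t, s))] with the point [((s, t), u)] of the target
    pullback. *)
Lemma Fcmap_assoc (I J K L : finType) (U : Span K L) (T : Span J K) (S : Span I J)
    (a_inv : @inv2 SpanFin _ _ _ _ (sp_assoc U T S)) (x : I -> C) l :
  F2map a_inv x l ∘ Fcmap (spcomp U T) S x l ∘ Fcmap U T (fam S x) l
  = Fcmap U (spcomp T S) x l ∘
    @fmap _ _ (spanFunctor M U) (fam T (fam S x) : ProdCat C K) (fam (spcomp T S) x : ProdCat C K)
      (fun k => Fcmap T S x k) l.
Proof.
pose lab (q : apex U * (apex T * apex S)) := sl S q.2.2.
(* The threefold iterated tensor product, with one label per triple. *)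
pose base3 := @presF K L U (fam T (fam S x)) _ _ _ (fun u =>
  @presF J K T (fam S x) _ _ _ (fun t => @presF I J S x _ _ (fun s => [:: (u, (t, s))])
    (fun s => leaf (fun q => x (lab q)) (u, (t, s))) (sl T t)) (sl U u)) l.
have H1 : canon (Lab (id_fam x) lab (fun q : apex (spcomp U T) * apex S => sl S q.2)
      (fun a b => val b.1 = (a.2.1, a.1) /\ a.2.2 = b.2))
    base3 (base2 (spcomp U T) S x l) (Fcmap U T (fam S x) l).
  apply: (@canon_Fc _ _ _ U T (fam S x) _ _ _ _ _ _ _ (fun u t =>
    @presF I J S x _ _ (fun s => [:: (u, (t, s))])
    (fun s => leaf (fun q => x (lab q)) (u, (t, s))) (sl T t))) => u t b φ E.
  (* The indices [sl T t] and [sl (spcomp U T) b] agree only through [E], so the map between them is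
     treated as a member of the graph of the identity family. *)
  apply: (@canon_Graph_id J (fam S x) _ _ _ _ _ _ _ (fun j =>
    @presF I J S x _ _ (fun s => [:: (u, (t, s))])
    (fun s => leaf (fun q => x (lab q)) (u, (t, s))) j) (fun j => presF _ j)) => j.
  by apply: canon_presF_id => s; apply: canon_leaf_id => //; apply: Graph_intro.
have H2 : canon (Lab (id_fam x) lab (fun q : apex U * apex (spcomp T S) => sl (spcomp T S) q.2)
      (fun a b => a.1 = b.1 /\ val b.2 = (a.2.2, a.2.1)))
    base3 (base2 U (spcomp T S) x l)
    (@fmap _ _ (spanFunctor M U) (fam T (fam S x) : ProdCat C K)
      (fam (spcomp T S) x : ProdCat C K) (fun k => Fcmap T S x k) l).
  apply: (@canon_fmap _ _ _ _ _ K L U (fam T (fam S x)) (fam (spcomp T S) x)) => u.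
  apply: (@canon_Fc _ _ _ T S x _ _ _ _ _ _ _ (fun t s =>
    leaf (fun q => x (lab q)) (u, (t, s)))) => t s b φ E G.
  by apply: canon_leaf_id.
apply: (Lab_eq (r := fun a b => val (val b).1 = (a.2.2, a.2.1) /\ (val b).2 = a.1)
  (canon_Lab_comp (id_famK x) (canon_F2_pres1 a_inv x l)
    (canon_Lab_comp (id_famK x) (canon_Fc_pres1 (spcomp U T) S x l) H1))
  (canon_Lab_comp (id_famK x) (canon_Fc_pres1 U (spcomp T S) x l) H2)).
- move=> [u [t s]] b [[[s' tu] h] /= [[tu' s''] /= [E <-]] [? ?] <-]; subst s' tu'.
  by rewrite smap_mk /= E.
- by move=> [u [t s]] b [[u' e] /= [-> E] ->].
- by move=> [u [t s]] [u' [t' s']] b /= [-> <-] [[-> ->] ->].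
- apply: (@uniq_flatten_map _ _ _ fst); first exact: fibre_uniq.
    move=> u; apply: (@uniq_flatten_map _ _ _ (fun q => q.2.1)); first exact: fibre_uniq.
      move=> t; apply: (@uniq_flatten_map _ _ _ (fun q => q.2.2)) => //; first exact: fibre_uniq.
      by move=> q s; rewrite inE => /eqP ->.
    by move=> q t /mem_flatten_map [s _]; rewrite inE => /eqP ->.
  by move=> q u /mem_flatten_map [t _] /mem_flatten_map [s _]; rewrite inE => /eqP ->.
- exact: is_iso_pres1.
Qed.

Section UnitAxioms.
Variables (J K : finType) (S : Span J K).

Let canon_1 (x : J -> C) k :
  canon (Lab (id_fam x) (sl S) (sl S) eq) (pres1 S x k) (pres1 S x k) 1.
Proof. by apply: canon_presF_id => a; apply: canon_leaf_id => //; apply: Graph_intro. Qed.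

(** A label [s] becomes a pair with second component [s] and is projected back, so the identity
    matching is realized. *)
Lemma Fcmap_lunit (u_inv : @inv2 SpanFin _ _ _ _ (sp_lunit S)) (x : J -> C) k :
  F2map u_inv x k ∘ Fcmap (spid K) S x k ∘ Fumap (fam S x) k = 1.
Proof.
have H : canon (Lab (id_fam x) (sl S) (fun q : apex (spid K) * apex S => sl S q.2)
      (fun a b => a = b.2))
    (pres1 S x k) (base2 (spid K) S x k) (Fumap (fam S x) k).
  apply: (@canon_Fu K (fam S x) _ _ _ _ _ _ _ _ _ (fun j => presF _ j)).
  by apply: canon_presF_id => a; apply: canon_leaf_id => //; apply: Graph_intro.
apply: (Lab_eq (r := eq) (canon_Lab_comp (id_famK x) (canon_F2_pres1 u_inv x k)
    (canon_Lab_comp (id_famK x) (canon_Fc_pres1 (spid K) S x k) H)) (canon_1 x k)) => //.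
- by move=> a b [c [d -> E] <-]; rewrite smap_mk E.
- by move=> a a' b -> ->.
- exact: uniq_pres1.
- exact: is_iso_pres1.
Qed.

Lemma Fcmap_runit (u_inv : @inv2 SpanFin _ _ _ _ (sp_runit S)) (x : J -> C) k :
  F2map u_inv x k ∘ Fcmap S (spid J) x k ∘
    @fmap _ _ (spanFunctor M S) (x : ProdCat C J) (fam (spid J) x : ProdCat C J)
      (fun j => Fumap x j) k = 1.
Proof.
have H : canon (Lab (id_fam x) (sl S) (fun q : apex S * apex (spid J) => sl (spid J) q.2)
      (fun a b => a = b.1))
    (pres1 S x k) (base2 S (spid J) x k)
    (@fmap _ _ (spanFunctor M S) (x : ProdCat C J) (fam (spid J) x : ProdCat C J)
      (fun j => Fumap x j) k).
  apply: (@canon_fmap _ _ _ _ _ J K S x (fam (spid J) x)) => s.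
  apply: (@canon_Fu J x _ _ _ _ _ _ _ _ _ (fun j => leaf (fun q => x q.2) (s, j))).
  by apply: canon_leaf_id => //; apply: Graph_intro.
apply: (Lab_eq (r := eq) (canon_Lab_comp (id_famK x) (canon_F2_pres1 u_inv x k)
    (canon_Lab_comp (id_famK x) (canon_Fc_pres1 S (spid J) x k) H)) (canon_1 x k)) => //.
- by move=> a b [c [d -> E] <-]; rewrite smap_mk E.
- by move=> a a' b -> ->.
- exact: uniq_pres1.
- exact: is_iso_pres1.
Qed.

End UnitAxioms.

End Coherence.

(** * Whiskering in [Cat] and the pseudofunctor *)

Lemma hcompN_id_r (B D E : Category) (G G' : Functor D E) (F : Functor B D)
    (t : NatTrans G G') x :
  ntc (hcompN t (idN F)) x = t (F x).
Proof. by rewrite /= fmap_id comp_id_r. Qed.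

Lemma hcompN_id_l (B D E : Category) (G : Functor D E) (F F' : Functor B D)
    (s : NatTrans F F') x :
  ntc (hcompN (idN G) s) x = fmap G (s x).
Proof. by rewrite /= comp_id_l. Qed.

Theorem theorem1p1 (C : Category) (M : SymMonoidal C) :
  inhabited
    (@Pseudofunctor PithSpanFin Cat
       (fun J : finType => ProdCat C J)
       (fun (J K : finType) (S : Span J K) => spanFunctor M S)).
Proof.
have vcompE (D E : Category) (F G H : Functor D E) (t : NatTrans G H) (s : NatTrans F G) x :
  ntc (vcompN t s) x = Defs.comp (t x) (s x) by [].
refine (inhabits (@Build_Pseudofunctor PithSpanFin Cat (fun J : finType => ProdCat C J)
  (fun (J K : finType) (S : Span J K) => spanFunctor M S)
  (* The pith supplies the invertibility of a 2-cell, which makes it match factors bijectively. *)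
  (fun J K S S' t => F2N M (proj2_sig t)) _ _
  (fun J K L T S => FcN M T S) _ _ (fun J => FuN M J) _ _ _ _)).
- move=> J K S; apply: NatTrans_eq => x; apply: functional_extensionality_dep => k.
  exact: F2map_id.
- move=> J K S S' S'' t s; apply: NatTrans_eq => x; apply: functional_extensionality_dep => k.
  exact: F2map_comp.
- move=> J K L T S; exact: FcN_inv.
- move=> J K L T T' S S' t s; apply: NatTrans_eq => x; apply: functional_extensionality_dep => k.
  exact: Fcmap_F2map.
- move=> J; exact: FuN_inv.
- move=> I J K L U T S; apply: NatTrans_eq => x.
  rewrite [LHS]vcompE [in LHS]vcompE hcompN_id_r.
  rewrite [RHS]vcompE [in RHS]vcompE hcompN_id_l.
  (* The associator of [Cat] has identity components. *)
  rewrite comp_id_r.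
  by apply: functional_extensionality_dep => k; apply: Fcmap_assoc.
- move=> J K S; apply: NatTrans_eq => x.
  rewrite [LHS]vcompE [in LHS]vcompE hcompN_id_r.
  by apply: functional_extensionality_dep => k; apply: Fcmap_lunit.
- move=> J K S; apply: NatTrans_eq => x.
  rewrite [LHS]vcompE [in LHS]vcompE hcompN_id_l.
  by apply: functional_extensionality_dep => k; apply: Fcmap_runit.
Qed.
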